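(* Let $n=m$, let $\mathbf{B}$ be nonsingular, and assume that the noise assumptions (A1) and (A2) of the context hold with $\sigma_{\mathbf{g}}=0$. Fix $\alpha\in(0,1)$ and write $\bar\eta=\bar\eta_{\mathbf{M}}(\alpha)$, $$\mathsf{RATE}=\sqrt{\frac{(1-\alpha)\bar\eta^2\lambda_{\min}(\mathbf{B}\mathbf{B}^\top)}{e^2}},$$ $$K_{\mathrm{thres}}(\alpha)=\left\lceil\left(\frac{4}{\sqrt{2\bar\eta^2(\sigma_{\mathbf{B}}^2+\bar\eta^2\sigma_{\mathbf{B},2}^2)+8\,\mathsf{RATE}}-\sqrt{2\bar\eta^2(\sigma_{\mathbf{B}}^2+\bar\eta^2\sigma_{\mathbf{B},2}^2)}}\right)^2\right\rceil .$$ Run the restarted iteration-averaged SEG method of the context with constant step size $\eta=\bar\eta_{\mathbf{M}}(\alpha)$ and restarting timestamps $\mathcal{T}_i=i\cdot K_{\mathrm{thres}}(\alpha)$, $i=1,2,\dots$. Then for all integers $K\ge1$ divisible by $K_{\mathrm{thres}}(\alpha)$, the output $\hat{\mathbf{x}}_K,\hat{\mathbf{y}}_K$ satisfies $$\mathbb{E}\left[\|\hat{\mathbf{x}}_K\|^2+\|\hat{\mathbf{y}}_K\|^2\right]\le\exp\left(-\frac{2}{K_{\mathrm{thres}}(\alpha)}\cdot K\right)\left[\|\mathbf{x}_0\|^2+\|\mathbf{y}_0\|^2\right].$$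
   Context: Notation: $a\wedge b=\min(a,b)$, $a\vee b=\max(a,b)$; $\lambda_{\max},\lambda_{\min}$ are the largest and smallest eigenvalues of a real symmetric matrix; $\|\cdot\|$ is the Euclidean norm, $\|\cdot\|_{op}$ the operator norm. Data: a random triple $(\mathbf{B}_\xi,\mathbf{g}^{\mathbf{x}}_\xi,\mathbf{g}^{\mathbf{y}}_\xi)$ with values in $\mathbb{R}^{n\times m}\times\mathbb{R}^n\times\mathbb{R}^m$; $\mathbb{E}_\xi$ is expectation over it. For $t\ge1$, $(\mathbf{B}_{\xi,t},\mathbf{g}^{\mathbf{x}}_{\xi,t},\mathbf{g}^{\mathbf{y}}_{\xi,t})$ are i.i.d. copies; $(\mathbf{x}_0,\mathbf{y}_0)\in\mathbb{R}^n\times\mathbb{R}^m$ is deterministic. Put $\mathbf{B}=\mathbb{E}_\xi[\mathbf{B}_\xi]$, $\mathbf{M}_\xi=\mathbf{B}_\xi\mathbf{B}_\xi^\top$, $\widehat{\mathbf{M}}_\xi=\mathbf{B}_\xi^\top\mathbf{B}_\xi$, $\mathbf{M}=\mathbb{E}_\xi\mathbf{M}_\xi$, $\widehat{\mathbf{M}}=\mathbb{E}_\xi\widehat{\mathbf{M}}_\xi$. (A1) $\lambda_{\max}(\mathbf{B}^\top\mathbf{B})>0$, $\lambda_{\min}(\mathbf{M})\wedge\lambda_{\min}(\widehat{\mathbf{M}})>0$, and $\sigma_{\mathbf{B}},\sigma_{\mathbf{B},2}\in[0,\infty)$ are such that $\|\mathbb{E}_\xi[(\mathbf{B}_\xi-\mathbf{B})^\top(\mathbf{B}_\xi-\mathbf{B})]\|_{op}\le\sigma_{\mathbf{B}}^2$,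 $\|\mathbb{E}_\xi[(\mathbf{B}_\xi-\mathbf{B})(\mathbf{B}_\xi-\mathbf{B})^\top]\|_{op}\le\sigma_{\mathbf{B}}^2$, $\|\mathbb{E}_\xi[(\widehat{\mathbf{M}}_\xi-\widehat{\mathbf{M}})^2]\|_{op}\le\sigma_{\mathbf{B},2}^2$, $\|\mathbb{E}_\xi[(\mathbf{M}_\xi-\mathbf{M})^2]\|_{op}\le\sigma_{\mathbf{B},2}^2$. (A2) $\sigma_{\mathbf{g}}\in[0,\infty)$ is such that $\mathbb{E}_\xi[\|\mathbf{g}^{\mathbf{x}}_\xi\|^2+\|\mathbf{g}^{\mathbf{y}}_\xi\|^2]\le\sigma_{\mathbf{g}}^2$; $\mathbb{E}_\xi[\mathbf{g}^{\mathbf{x}}_\xi]=\mathbf{0}$, $\mathbb{E}_\xi[\mathbf{g}^{\mathbf{y}}_\xi]=\mathbf{0}$; and $\mathbf{B}_\xi$ is independent of $[\mathbf{g}^{\mathbf{x}}_\xi;\mathbf{g}^{\mathbf{y}}_\xi]$. (When $\sigma_{\mathbf{g}}=0$ the vectors $\mathbf{g}^{\mathbf{x}}_\xi,\mathbf{g}^{\mathbf{y}}_\xi$ vanish almost surely: the interpolation setting.) (SEG step) With step size $\eta$, at time $t\ge1$: $\mathbf{x}_{t-1/2}=\mathbf{x}_{t-1}-\eta[\mathbf{B}_{\xi,t}\mathbf{y}_{t-1}+\mathbf{g}^{\mathbf{x}}_{\xi,t}]$, $\mathbf{y}_{t-1/2}=\mathbf{y}_{t-1}+\eta[\mathbf{B}_{\xi,t}^\top\mathbf{x}_{t-1}+\mathbf{g}^{\mathbf{y}}_{\xi,t}]$,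 $\mathbf{x}_t=\mathbf{x}_{t-1}-\eta[\mathbf{B}_{\xi,t}\mathbf{y}_{t-1/2}+\mathbf{g}^{\mathbf{x}}_{\xi,t}]$, $\mathbf{y}_t=\mathbf{y}_{t-1}+\eta[\mathbf{B}_{\xi,t}^\top\mathbf{x}_{t-1/2}+\mathbf{g}^{\mathbf{y}}_{\xi,t}]$. (Restarted iteration-averaged SEG) Put $\mathcal{T}_0=0$ and let $\mathcal{T}_1<\mathcal{T}_2<\cdots$ be the restarting timestamps. Starting from $(\mathbf{x}_0,\mathbf{y}_0)$, perform SEG steps $t=1,2,\dots$. For $\mathcal{T}_{i-1}<t\le\mathcal{T}_i$ maintain the running averages over the current epoch $\hat{\mathbf{x}}_t=\frac{1}{t-\mathcal{T}_{i-1}}\sum_{s=\mathcal{T}_{i-1}+1}^{t}\mathbf{x}_s$ and $\hat{\mathbf{y}}_t=\frac{1}{t-\mathcal{T}_{i-1}}\sum_{s=\mathcal{T}_{i-1}+1}^{t}\mathbf{y}_s$. At $t=\mathcal{T}_i$, after computing $\hat{\mathbf{x}}_t,\hat{\mathbf{y}}_t$, restart: overwrite $\mathbf{x}_t\leftarrow\hat{\mathbf{x}}_t$, $\mathbf{y}_t\leftarrow\hat{\mathbf{y}}_t$. The output after $K$ steps is $(\hat{\mathbf{x}}_K,\hat{\mathbf{y}}_K)$. Step size: $\eta_{\mathbf{M}}=1/\sqrt{\rho_1\vee\rho_2}$ with $\rho_1=\lambda_{\max}(\mathbf{M}^{-1/2}[\mathbb{E}_\xi\mathbf{M}_\xi^2]\mathbf{M}^{-1/2})$,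 $\rho_2=\lambda_{\max}(\widehat{\mathbf{M}}^{-1/2}[\mathbb{E}_\xi\widehat{\mathbf{M}}_\xi^2]\widehat{\mathbf{M}}^{-1/2})$, and $$\bar\eta_{\mathbf{M}}(\alpha)=\eta_{\mathbf{M}}\wedge\frac{\alpha\lambda_{\min}(\mathbf{B}\mathbf{B}^\top)}{2\sigma_{\mathbf{B}}^2\sqrt{\lambda_{\max}(\mathbf{B}^\top\mathbf{B})}},$$ where the second term is read as $+\infty$ if $\sigma_{\mathbf{B}}=0$. *)

(* Defs.v *)
From HB Require Import structures.
From mathcomp Require Import all_boot all_order all_algebra finmap.
From mathcomp Require Import all_classical all_reals all_analysis.

Set Implicit Arguments.
Unset Strict Implicit.
Unset Printing Implicit Defensive.
Import Order.TTheory GRing.Theory Num.Theory.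

Local Open Scope classical_set_scope.
Local Open Scope ring_scope.

(* Borel sigma-algebra on matrices: the one generated by the entries.  Products
   of matrix types then carry the product sigma-algebra of the library. *)
Section matrix_measurable.
Context d (T : measurableType d) (n m : nat).

Definition mx_entry_preimages : set (set 'M[T]_(n, m)) :=
  \bigcup_(ij in [set: 'I_n * 'I_m])
    preimage_set_system setT (fun A : 'M[T]_(n, m) => A ij.1 ij.2) measurable.

HB.instance Definition _ := @isMeasurable.Build (sigma_display mx_entry_preimages)
  'M[T]_(n, m) <<s mx_entry_preimages >>
  (@sigma_algebra0 _ setT mx_entry_preimages)
  (@sigma_algebraC _ mx_entry_preimages)
  (@sigma_algebra_bigcup _ setT mx_entry_preimages).

End matrix_measurable.

Section linear_algebra.
Context (R : realType).

Definition enorm (n : nat) (v : 'cV[R]_n) : R := Num.sqrt (\sum_i v i 0 ^+ 2).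

Definition opnorm (n m : nat) (A : 'M[R]_(n, m)) : R :=
  sup [set enorm (A *m v) | v in [set v : 'cV[R]_m | enorm v <= 1]].

(* Only used on symmetric matrices of positive size, whose (real) spectrum is
   finite and nonempty: there sup and inf are a maximum and a minimum. *)
Definition lambda_max (n : nat) (A : 'M[R]_n) : R := sup [set a | eigenvalue A a].
Definition lambda_min (n : nat) (A : 'M[R]_n) : R := inf [set a | eigenvalue A a].

Definition psd (n : nat) (A : 'M[R]_n) : Prop :=
  A^T = A /\ forall v : 'cV[R]_n, 0 <= (v^T *m A *m v) 0 0.

(* The unique positive semidefinite square root when [psd A]; junk otherwise. *)
Definition sqrtmx (n : nat) (A : 'M[R]_n) : 'M[R]_n :=
  xget 0 [set S | psd S /\ S *m S = A].

Definition invsqrtmx (n : nat) (A : 'M[R]_n) : 'M[R]_n := invmx (sqrtmx A).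

End linear_algebra.

Section probability.
Context d (Omega : measurableType d) (R : realType) (P : probability Omega R).

Definition mx_integrable (n m : nat) (Y : Omega -> 'M[R]_(n, m)) : Prop :=
  forall i j, P.-integrable setT (fun w => (Y w i j)%:E).

(* Entrywise expectation; meaningful when [mx_integrable Y]. *)
Definition Emx (n m : nat) (Y : Omega -> 'M[R]_(n, m)) : 'M[R]_(n, m) :=
  \matrix_(i, j) fine ('E_P[fun w => Y w i j])%E.

Definition independent2 d1 d2 (T1 : measurableType d1) (T2 : measurableType d2)
    (X : Omega -> T1) (Y : Omega -> T2) : Prop :=
  forall A C, measurable A -> measurable C ->
    P (X @^-1` A `&` Y @^-1` C) = (P (X @^-1` A) * P (Y @^-1` C))%E.

Definition independent_family (I : choiceType) (D : set I)
    d' (T : measurableType d') (X : I -> Omega -> T) : Prop :=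
  forall (J : {fset I}) (A : I -> set T),
    [set` J] `<=` D -> (forall i, measurable (A i)) ->
    P (\bigcap_(i in [set` J]) (X i @^-1` A i)) =
    (\prod_(i <- J) P (X i @^-1` A i))%E.

End probability.

(* Values of the random triple, grouped as ((B, gx), gy). *)
Notation triple R n m := ('M[R]_(n, m) * 'cV[R]_n * 'cV[R]_m)%type.

Section data.
Context d (Omega : measurableType d) (R : realType) (P : probability Omega R).
Context (n m : nat) (xi : Omega -> triple R n m).

Definition Bxi (w : Omega) : 'M[R]_(n, m) := (xi w).1.1.
Definition gx (w : Omega) : 'cV[R]_n := (xi w).1.2.
Definition gy (w : Omega) : 'cV[R]_m := (xi w).2.
Definition Mxi (w : Omega) : 'M[R]_n := Bxi w *m (Bxi w)^T.
Definition Mhatxi (w : Omega) : 'M[R]_m := (Bxi w)^T *m Bxi w.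

Definition Bmean : 'M[R]_(n, m) := Emx P Bxi.
Definition Mmean : 'M[R]_n := Emx P Mxi.
Definition Mhatmean : 'M[R]_m := Emx P Mhatxi.
Definition M2mean : 'M[R]_n := Emx P (fun w => Mxi w *m Mxi w).
Definition Mhat2mean : 'M[R]_m := Emx P (fun w => Mhatxi w *m Mhatxi w).

(* Existence of the matrix expectations above, usually left implicit;
   that of the centered moments below follows. *)
Definition moments_exist : Prop :=
  [/\ mx_integrable P Bxi, mx_integrable P Mxi, mx_integrable P Mhatxi,
      mx_integrable P (fun w => Mxi w *m Mxi w)
    & mx_integrable P (fun w => Mhatxi w *m Mhatxi w)].

Record noiseB (sigmaB sigmaB2 : R) : Prop := NoiseB {
  noiseB_moments : moments_exist;
  noiseB_neq0 : 0 < lambda_max (Bmean^T *m Bmean);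
  noiseB_pos : 0 < Num.min (lambda_min Mmean) (lambda_min Mhatmean);
  noiseB_sigma_ge0 : 0 <= sigmaB;
  noiseB_sigma2_ge0 : 0 <= sigmaB2;
  noiseB_var_l :
    opnorm (Emx P (fun w => (Bxi w - Bmean)^T *m (Bxi w - Bmean)))
      <= sigmaB ^+ 2;
  noiseB_var_r :
    opnorm (Emx P (fun w => (Bxi w - Bmean) *m (Bxi w - Bmean)^T))
      <= sigmaB ^+ 2;
  noiseB_var_Mhat :
    opnorm (Emx P (fun w => (Mhatxi w - Mhatmean) *m (Mhatxi w - Mhatmean)))
      <= sigmaB2 ^+ 2;
  noiseB_var_M :
    opnorm (Emx P (fun w => (Mxi w - Mmean) *m (Mxi w - Mmean)))
      <= sigmaB2 ^+ 2 }.

(* The second-moment bound holds in [\bar R], so it also gives integrability of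
   [gx] and [gy]. *)
Record noiseg (sigmag : R) : Prop := Noiseg {
  noiseg_sigma_ge0 : 0 <= sigmag;
  noiseg_var : ('E_P[fun w => (enorm (gx w) ^+ 2 + enorm (gy w) ^+ 2)%R]
                  <= (sigmag ^+ 2)%:E)%E;
  noiseg_meanx : Emx P gx = 0;
  noiseg_meany : Emx P gy = 0;
  noiseg_indep : independent2 P Bxi (fun w => col_mx (gx w) (gy w)) }.

Definition rho1 : R :=
  lambda_max (invsqrtmx Mmean *m M2mean *m invsqrtmx Mmean).
Definition rho2 : R :=
  lambda_max (invsqrtmx Mhatmean *m Mhat2mean *m invsqrtmx Mhatmean).

Definition etaM : R := (Num.sqrt (Num.max rho1 rho2))^-1.

Definition etabar (sigmaB alpha : R) : R :=
  if sigmaB == 0 then etaM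
  else Num.min etaM
         (alpha * lambda_min (Bmean *m Bmean^T)
            / (2 * sigmaB ^+ 2 * Num.sqrt (lambda_max (Bmean^T *m Bmean)))).

Definition RATE (sigmaB alpha : R) : R :=
  Num.sqrt ((1 - alpha) * etabar sigmaB alpha ^+ 2
              * lambda_min (Bmean *m Bmean^T) / expR 1 ^+ 2).

Definition Kthres (sigmaB sigmaB2 alpha : R) : nat :=
  let eta := etabar sigmaB alpha in
  let v := 2 * eta ^+ 2 * (sigmaB ^+ 2 + eta ^+ 2 * sigmaB2 ^+ 2) in
  `|Num.ceil
      ((4 / (Num.sqrt (v + 8 * RATE sigmaB alpha) - Num.sqrt v)) ^+ 2)|%N.

End data.

Section iid_copies.
Context d0 (Omega0 : measurableType d0) d (Omega : measurableType d).
Context (R : realType) (P0 : probability Omega0 R) (P : probability Omega R).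
Context d' (T : measurableType d').

(* Only the indices t >= 1 matter. *)
Definition iid_copies (xi : {RV P0 >-> T}) (X : nat -> {RV P >-> T}) : Prop :=
  independent_family P [set t | (1 <= t)%N] (fun t => X t : Omega -> T) /\
  forall t, (1 <= t)%N -> forall A, measurable A ->
    distribution P (X t) A = distribution P0 xi A.

End iid_copies.

Section algorithm.
Context (R : realType) (n m : nat).
Notation iterate := ('cV[R]_n * 'cV[R]_m)%type.

Definition seg_step (eta : R) (s : triple R n m) (z : iterate) : iterate :=
  let B := s.1.1 in
  let gx := s.1.2 in
  let gy := s.2 in
  let x := z.1 in
  let y := z.2 in
  let x_half := x - eta *: (B *m y + gx) in
  let y_half := y + eta *: (B^T *m x + gy) in
  (x - eta *: (B *m y_half + gx), y + eta *: (B^T *m x_half + gy)).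

(* State after step t: [rs_cur] is (x_t, y_t) after a possible overwriting,
   [rs_start] the last restarting timestamp <= t, [rs_sum] the sum of the
   iterates of the running epoch, [rs_avg] the output (x^_t, y^_t). *)
Record rseg_state := RsegState {
  rs_cur : iterate;
  rs_start : nat;
  rs_sum : iterate;
  rs_avg : iterate }.

Definition restarts (T : nat -> nat) : set nat := [set T i | i in [set i | (1 <= i)%N]].

(* [s t] is the sample used at step t >= 1. *)
Fixpoint rseg (T : nat -> nat) (eta : R) (s : nat -> triple R n m)
    (z0 : iterate) (t : nat) : rseg_state :=
  if t is t'.+1 then
    let st := rseg T eta s z0 t' in
    let z := seg_step eta (s t) (rs_cur st) in
    let S := rs_sum st + z in
    let a := ((t - rs_start st)%:R : R)^-1 *: S in
    if t \in restarts T then RsegState a t 0 a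
    else RsegState z (rs_start st) S a
  else RsegState z0 0 0 z0.

Definition rseg_output (T : nat -> nat) (eta : R) (s : nat -> triple R n m)
    (z0 : iterate) (K : nat) : iterate := rs_avg (rseg T eta s z0 K).

End algorithm.

(* Main.v *)
From HB Require Import structures.
Require Import Defs.
From mathcomp Require Import all_boot all_order all_algebra finmap.
From mathcomp Require Import all_classical all_reals all_analysis.
From mathcomp Require Import measurable_realfun.
From mathcomp Require Import ring lra.

Set Implicit Arguments.
Unset Strict Implicit.
Unset Printing Implicit Defensive.
Import Order.TTheory GRing.Theory Num.Theory.
Local Open Scope classical_set_scope.
Local Open Scope ring_scope.

(** Almost surely the vectors [gx] and [gy] vanish, so that a SEG step acts
    linearly on the stacked iterate z = [x; y]:
      z_t = (1 - H_t) z_(t-1),   H_t = eta J_t + eta^2 D_t,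
    where J_t = [0 B_t; - B_t^T 0] is skew and D_t = - J_t^2 is the block
    diagonal matrix of B_t B_t^T and B_t^T B_t.  Let H be the mean of H_t and
    put lam = lambda_min (B B^T), v = 2 eta^2 (sigmaB^2 + eta^2 sigmaB2^2).
    Three facts carry the proof.

    - [segF_nonexpansive]: as J_t is skew and commutes with D_t,
      |(1 - H_t) z|^2 = |z|^2 - eta^2 <z, D_t z> + eta^4 <z, D_t^2 z>, and
      eta <= eta_M makes the mean of the last two terms nonpositive.  A step
      therefore never increases the mean square of the iterate.
    - [segF_variance]: E |(H_t - H) z|^2 <= v |z|^2.
    - [segF_coercive]: |H z|^2 >= (1 - alpha) eta^2 lam |z|^2.  Up to eta^2
      times a covariance of norm at most sigmaB^2, H is the operator eta J +
      eta^2 D of the mean matrix B.  The vectors J z and D z are orthogonal,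
      and |J z|^2 >= lam |z|^2 because B is square and nonsingular; the second
      bound on eta lets the fraction alpha of eta^2 |J z|^2 absorb the
      perturbation.

    Iterates that circulate around the saddle point need not get smaller, but
    their averages do.  Within an epoch started at z_0, the identity
    H z_s = z_s - z_(s+1) - (H_(s+1) - H) z_s telescopes over s = 1, ..., k to
      H (z_1 + ... + z_k) = z_1 - z_(k+1) - martingale,
    where z_(k+1) comes from a step that serves the analysis only, and the
    martingale has orthogonal increments of variance at most v E |z_0|^2.
    Hence ([epoch_le])
      sqrt ((1 - alpha) eta^2 lam) ||z_1 + ... + z_k|| <= (2 + sqrt (k v)) ||z_0||
    in the norm ||z||^2 = E |z|^2.  The length K_thres makes the right-hand
    factor at most k RATE ([epoch_length_bound]), and RATE is the left-hand
    factor divided by e: the average over an epoch is at least e times smaller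
    than the starting point of that epoch ([restart_contraction]), and this
    average is the starting point of the next one.

    The probabilistic input is that the sample of step t + 1 is independent of
    the sigma-algebra of the first t samples ([past_indep]), so that a fresh
    random matrix between two vectors of the past may be replaced by its mean
    ([Rintegral_fresh_form]).  The algebraic input is the Rayleigh bound for the
    extreme eigenvalues of symmetric matrices and the existence of positive
    semidefinite square roots. *)

(** * The dot product and symmetric matrices *)

Section dot_product.
Context {R : realType}.

Definition dot n (u v : 'cV[R]_n) : R := (u^T *m v) 0 0.

Lemma dotE n (u v : 'cV[R]_n) : dot u v = \sum_i u i 0 * v i 0.
Proof. by rewrite /dot mxE; apply: eq_bigr => i _; rewrite mxE. Qed.

Lemma dotC n (u v : 'cV[R]_n) : dot u v = dot v u.
Proof. by rewrite !dotE; apply: eq_bigr => i _; rewrite mulrC. Qed.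

Lemma dotDr n (u v w : 'cV[R]_n) : dot u (v + w) = dot u v + dot u w.
Proof. by rewrite /dot mulmxDr mxE. Qed.

Lemma dotDl n (u v w : 'cV[R]_n) : dot (v + w) u = dot v u + dot w u.
Proof. by rewrite dotC dotDr !(dotC u). Qed.

Lemma dotZr n a (u v : 'cV[R]_n) : dot u (a *: v) = a * dot u v.
Proof. by rewrite /dot -scalemxAr mxE. Qed.

Lemma dotZl n a (u v : 'cV[R]_n) : dot (a *: u) v = a * dot u v.
Proof. by rewrite dotC dotZr dotC. Qed.

Lemma dotNr n (u v : 'cV[R]_n) : dot u (- v) = - dot u v.
Proof. by rewrite -scaleN1r dotZr mulN1r. Qed.

Lemma dotNl n (u v : 'cV[R]_n) : dot (- u) v = - dot u v.
Proof. by rewrite dotC dotNr dotC. Qed.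

Lemma dotBr n (u v w : 'cV[R]_n) : dot u (v - w) = dot u v - dot u w.
Proof. by rewrite dotDr dotNr. Qed.

Lemma dotBl n (u v w : 'cV[R]_n) : dot (v - w) u = dot v u - dot w u.
Proof. by rewrite dotDl dotNl. Qed.

Lemma dot0r n (u : 'cV[R]_n) : dot u 0 = 0.
Proof. by rewrite /dot mulmx0 mxE. Qed.

Lemma dot_adj n m (A : 'M[R]_(n, m)) u v : dot u (A *m v) = dot (A^T *m u) v.
Proof. by rewrite /dot trmx_mul trmxK mulmxA. Qed.

Lemma dot_ge0 n (u : 'cV[R]_n) : 0 <= dot u u.
Proof. by rewrite dotE sumr_ge0 // => i _; rewrite -expr2 sqr_ge0. Qed.

Lemma dot_eq0 n (u : 'cV[R]_n) : (dot u u == 0) = (u == 0).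
Proof.
apply/idP/eqP => [|->]; last by rewrite dot0r.
rewrite dotE psumr_eq0 => [/allP h|i _]; last by rewrite -expr2 sqr_ge0.
apply/colP => i; rewrite mxE; apply/eqP; have := h i (mem_index_enum i).
by rewrite mulf_eq0 orbb.
Qed.

Lemma dot_gt0 n (u : 'cV[R]_n) : u != 0 -> 0 < dot u u.
Proof. by move=> u0; rewrite lt_neqAle dot_ge0 eq_sym dot_eq0 u0. Qed.

Lemma dot_col_mx n m (a c : 'cV[R]_n) (b e : 'cV[R]_m) :
  dot (col_mx a b) (col_mx c e) = dot a c + dot b e.
Proof. by rewrite /dot tr_col_mx mul_row_col mxE. Qed.

Lemma enorm_sqr n (v : 'cV[R]_n) : enorm v ^+ 2 = dot v v.
Proof.
rewrite /enorm sqr_sqrtr; last by rewrite sumr_ge0 // => i _; exact: sqr_ge0.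
by rewrite dotE; apply: eq_bigr => i _; rewrite expr2.
Qed.

Lemma enorm_ge0 n (v : 'cV[R]_n) : 0 <= enorm v.
Proof. exact: sqrtr_ge0. Qed.

(** This form covers [c = 0], where [b] must vanish. *)
Lemma quad_ge0_discr (a b c : R) : (forall t, 0 <= a + 2 * b * t + c * t ^+ 2) ->
  b ^+ 2 <= a * c.
Proof.
move=> h; have [c0|c0] := eqVneq c 0.
  have [->|b0] := eqVneq b 0; first by rewrite c0 mulr0 expr0n.
  have := h (- (a + 1) / (2 * b)).
  have -> : a + 2 * b * (- (a + 1) / (2 * b)) + c * (- (a + 1) / (2 * b)) ^+ 2 = -1.
    by rewrite c0; field.
  by rewrite lerNr oppr0 ler10.
have cp : 0 < c.
  rewrite lt_neqAle eq_sym c0 /= leNgt; apply/negP => cn.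
  have a0 : 0 <= a by have := h 0; rewrite mulr0 expr0n /= mulr0 !addr0.
  (* a negative c makes the polynomial negative at t or at - t for large t *)
  have h1 := h (1 + (a + `|b| + `|b|) / - c).
  have h2 := h (- (1 + (a + `|b| + `|b|) / - c)).
  set t := (1 + _) in h1 h2.
  have ht : 1 <= t by rewrite /t lerDl divr_ge0 // ?addr_ge0 // oppr_ge0 ltW.
  have hct : c * t = c - (a + `|b| + `|b|) by rewrite /t; field.
  have : 0 <= 2 * (a + c * t ^+ 2) by lra.
  rewrite expr2 mulrA hct.
  have := normr_ge0 b; nra.
have := h (- b / c).
have -> : a + 2 * b * (- b / c) + c * (- b / c) ^+ 2 = (a * c - b ^+ 2) / c by field.
by rewrite pmulr_lge0 ?invr_gt0 // subr_ge0.
Qed.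

End dot_product.

Section symmetric_matrices.
Context {R : realType}.

Lemma psd_dot n (A : 'M[R]_n) : psd A <-> A^T = A /\ forall v, 0 <= dot v (A *m v).
Proof.
by split=> -[h k]; split=> // v; have := k v; rewrite /dot mulmxA.
Qed.

Lemma dot_sym n (A : 'M[R]_n) u v : A^T = A -> dot u (A *m v) = dot (A *m u) v.
Proof. by move=> h; rewrite dot_adj h. Qed.

Lemma psd_cauchy_schwarz n (A : 'M[R]_n) u v : psd A ->
  dot u (A *m v) ^+ 2 <= dot u (A *m u) * dot v (A *m v).
Proof.
move=> /psd_dot[sA pA]; apply: quad_ge0_discr => t.
have := pA (u + t *: v).
rewrite mulmxDr -scalemxAr !dotDr !dotDl !dotZr !dotZl (dot_sym v u sA).
rewrite (dotC (A *m v) u) => h; apply: le_trans h _.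
by rewrite le_eqVlt; apply/orP; left; apply/eqP; ring.
Qed.

Lemma cauchy_schwarz n (u v : 'cV[R]_n) : dot u v ^+ 2 <= dot u u * dot v v.
Proof.
have := @psd_cauchy_schwarz n 1%:M u v; rewrite !mul1mx; apply.
by apply/psd_dot; split=> [|w]; rewrite ?trmx1// mul1mx dot_ge0.
Qed.

Lemma mulmx_bounded n m (A : 'M[R]_(n, m)) :
  exists2 C, 0 < C & forall v, dot (A *m v) (A *m v) <= C * dot v v.
Proof.
exists (1 + \sum_i dot (row i A)^T (row i A)^T) => [|v].
  by rewrite ltr_pwDl // sumr_ge0 // => i _; exact: dot_ge0.
rewrite mulrDl mul1r ler_wpDl ?dot_ge0 // mulr_suml dotE ler_sum // => i _.
rewrite -expr2; have -> : (A *m v) i 0 = dot (row i A)^T v.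
  by rewrite /dot trmxK -row_mul [RHS]mxE.
exact: cauchy_schwarz.
Qed.

(** Cauchy-Schwarz for the form of [A], applied to [A v] and [v]: the vector
    [A v] is small wherever the form is. *)
Lemma psd_norm_le n (A : 'M[R]_n) : psd A ->
  exists2 K, 0 < K & forall v, dot (A *m v) (A *m v) <= K * dot v (A *m v).
Proof.
move=> pA; have [C C0 hC] := mulmx_bounded A.
exists (C + 1) => [|v]; first by rewrite addr_gt0.
have [->|v0] := eqVneq (A *m v) 0; first by rewrite !dot0r mulr0.
set w := A *m v.
have := psd_cauchy_schwarz w v pA; rewrite -/w.
have w0 := dot_gt0 v0; rewrite -/w in w0.
have h1 : dot w (A *m w) <= (C + 1) * dot w w.
  have := dot_ge0 (A *m w - w); rewrite dotBl !dotBr (dotC (A *m w) w).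
  have := hC w; have := dot_ge0 (A *m w); lra.
have /psd_dot[_ /(_ v)] := pA; rewrite -/w => p0.
move=> h; have : dot w w ^+ 2 <= (C + 1) * dot w w * dot v w.
  by apply: le_trans h _; exact: ler_wpM2r.
by rewrite expr2 [X in _ <= X]mulrAC ler_pM2r.
Qed.

Lemma eigenvalue_dot n (A : 'M[R]_n) a : A^T = A -> eigenvalue A a ->
  exists2 v : 'cV[R]_n, v != 0 & A *m v = a *: v.
Proof.
move=> sA /eigenvalueP[v hv v0]; exists v^T; first by rewrite trmx_eq0.
by rewrite -{1}sA -trmx_mul hv linearZ.
Qed.

(** Take the supremum [mu] of the Rayleigh quotients.  If the positive
    semidefinite matrix [mu - A] were invertible, [psd_norm_le] would bound its
    form below by a positive multiple of the squared norm, and [mu] could be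
    lowered: so [mu] is an eigenvalue. *)
Lemma rayleigh_max n (A : 'M[R]_n) : (0 < n)%N -> A^T = A ->
  exists2 mu, eigenvalue A mu & forall v, dot v (A *m v) <= mu * dot v v.
Proof.
move=> n0 sA.
pose S := [set dot v (A *m v) / dot v v | v in [set v : 'cV[R]_n | v != 0]].
have [C C0 hC] := mulmx_bounded A.
have hS : has_sup S.
  split.
    pose v : 'cV[R]_n := const_mx 1.
    exists (dot v (A *m v) / dot v v), v => //=.
    apply/eqP => /colP /(_ (Ordinal n0)); rewrite !mxE; apply/eqP; exact: oner_neq0.
  exists (C + 1) => _ [v /= v0 <-]; rewrite ler_pdivrMr ?dot_gt0 //.
  have := dot_ge0 (A *m v - v); rewrite dotBl !dotBr (dotC (A *m v) v).
  have := hC v; have := dot_ge0 v; have := dot_ge0 (A *m v); lra.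
pose mu := sup S.
have hmu v : dot v (A *m v) <= mu * dot v v.
  have [->|v0] := eqVneq v 0; first by rewrite mulmx0 dot0r mulr0.
  rewrite -ler_pdivrMr ?dot_gt0 //; apply: sup_ubound; first by case: hS.
  by exists v.
exists mu => //; pose N := mu%:M - A.
have Nv v : N *m v = mu *: v - A *m v by rewrite mulmxBl mul_scalar_mx.
have pN : psd N.
  apply/psd_dot; split=> [|v]; first by rewrite linearB /= tr_scalar_mx sA.
  by rewrite Nv dotBr dotZr subr_ge0.
have : ~~ (N \in unitmx).
  apply/negP => uN.
  have [K K0 hK] := psd_norm_le pN; have [D D0 hD] := mulmx_bounded (invmx N).
  have DK0 : 0 < D * K by exact: mulr_gt0.
  have : mu <= mu - (D * K)^-1.
    apply: ge_sup; first by case: hS.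
    move=> _ [v /= v0 <-]; rewrite ler_pdivrMr ?dot_gt0 //.
    have := hD (N *m v); rewrite mulKmx // => h1.
    have h2 : dot v v <= D * K * dot v (N *m v).
      by apply: le_trans h1 _; rewrite -mulrA ler_wpM2l // ltW.
    rewrite -ler_pdivrMl // Nv dotBr dotZr in h2.
    by rewrite mulrBl; lra.
  have : 0 < (D * K)^-1 by rewrite invr_gt0.
  lra.
rewrite -row_free_unit -kermx_eq0 => h.
rewrite /eigenvalue /eigenspace; apply: contra h => /eqP h.
have -> : N = - (A - mu%:M) by rewrite opprB.
apply/eqP/row_matrixP => i; rewrite row0.
have : (row i (kermx (- (A - mu%:M))) <= kermx (A - mu%:M))%MS.
  apply/sub_kermxP; apply/eqP; rewrite -oppr_eq0 -mulmxN; apply/eqP.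
  by rewrite -row_mul mulmx_ker row0.
by rewrite h submx0 => /eqP.
Qed.

Lemma lambda_max_spec n (A : 'M[R]_n) : (0 < n)%N -> A^T = A ->
  eigenvalue A (lambda_max A) /\
  forall v, dot v (A *m v) <= lambda_max A * dot v v.
Proof.
move=> n0 sA; have [mu emu hmu] := rayleigh_max n0 sA.
suff -> : lambda_max A = mu by [].
have ub : ubound [set a | eigenvalue A a] mu.
  move=> a /= /(eigenvalue_dot sA)[v v0 hv].
  by have := hmu v; rewrite hv dotZr ler_pM2r ?dot_gt0.
apply/le_anti/andP; split; first by apply: ge_sup => //; exists mu.
by apply: sup_ubound => //; exists mu.
Qed.

Lemma lambda_min_spec n (A : 'M[R]_n) : (0 < n)%N -> A^T = A ->
  eigenvalue A (lambda_min A) /\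
  forall v, lambda_min A * dot v v <= dot v (A *m v).
Proof.
move=> n0 sA.
have sN : (- A)^T = - A by rewrite linearN /= sA.
have [e h] := lambda_max_spec n0 sN.
suff -> : lambda_min A = - lambda_max (- A).
  split; last by move=> v; have := h v; rewrite mulNmx dotNr mulNr lerNl.
  move: e => /eigenvalueP[v hv v0]; apply/eigenvalueP; exists v => //.
  by rewrite scaleNr -hv mulmxN opprK.
rewrite /lambda_min /inf /lambda_max; congr (- sup _).
apply/seteqP; split=> a /=.
  move=> [b /= /eigenvalueP[v hv v0] <-]; apply/eigenvalueP; exists v => //.
  by rewrite mulmxN hv scaleNr.
move=> /eigenvalueP[v hv v0]; exists (- a); rewrite ?opprK //=.
by apply/eigenvalueP; exists v => //; rewrite scaleNr -hv mulmxN opprK.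
Qed.

Lemma lambda_max_ge n (A : 'M[R]_n) v : A^T = A ->
  dot v (A *m v) <= lambda_max A * dot v v.
Proof.
case: n A v => [|n] A v sA; last by apply: (lambda_max_spec _ sA).2.
by rewrite (flatmx0 v) mulmx0 dot0r mulr0.
Qed.

Lemma lambda_min_le n (A : 'M[R]_n) v : A^T = A ->
  lambda_min A * dot v v <= dot v (A *m v).
Proof.
case: n A v => [|n] A v sA; last by apply: (lambda_min_spec _ sA).2.
by rewrite (flatmx0 v) mulmx0 dot0r mulr0.
Qed.

(** Induction on the rank.  For a unit eigenvector [u] of the top eigenvalue
    [mu], deflation [A - mu u u^T] lowers the rank, and a root [S] of the
    deflated matrix kills [u]; so [S + sqrt mu u u^T] is a root of [A]. *)
Lemma psd_sqrt_exists n (A : 'M[R]_n) : psd A ->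
  exists S, psd S /\ S *m S = A.
Proof.
have [r] := ubnP (\rank A); elim: r A => // r IH A rA pA.
have [A0|A0] := eqVneq A 0.
  by exists 0; rewrite mulmx0 A0; split=> //; rewrite -A0.
have n0 : (0 < n)%N by case: n A A0 {IH rA pA} => // A; rewrite flatmx0 eqxx.
have /psd_dot[sA qA] := pA.
have [mu emu hmu] := rayleigh_max n0 sA.
have mu0 : 0 < mu.
  rewrite ltNge; apply/negP => mu0; move/negP: A0; apply.
  have qA0 v : dot v (A *m v) <= 0.
    by rewrite (le_trans (hmu v)) // mulr_le0_ge0 ?dot_ge0.
  suff Av0 (v : 'cV[R]_n) : A *m v = 0.
    by apply/eqP/matrixP => i j; have /colP/(_ i) := Av0 (delta_mx j 0);
      rewrite -colE !mxE.
  apply/eqP; rewrite -dot_eq0 -sqrf_eq0 eq_le sqr_ge0 andbT.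
  apply: le_trans (psd_cauchy_schwarz _ _ pA) _.
  by rewrite mulr_ge0_le0 ?qA.
have [v v0 hv] := eigenvalue_dot sA emu.
pose u := (Num.sqrt (dot v v))^-1 *: v.
have uu : u^T *m u = 1%:M.
  apply/matrixP => i j; rewrite !ord1 -/(dot u u) /u dotZl dotZr mulrA -expr2 !mxE eqxx.
  by rewrite exprVn sqr_sqrtr ?dot_ge0 // mulVf // gt_eqF // dot_gt0.
have hu : A *m u = mu *: u by rewrite /u -scalemxAr hv !scalerA mulrC.
clearbody u.
have hu' : u^T *m A = mu *: u^T by rewrite -{1}sA -trmx_mul hu linearZ.
pose Q := 1%:M - u *m u^T.
have Qu : Q *m u = 0 by rewrite mulmxBl mul1mx -mulmxA uu mulmx1 subrr.
have sQ : Q^T = Q by rewrite linearB /= trmx1 trmx_mul trmxK.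
pose A' := Q *m A.
have A'E : A' = A - mu *: (u *m u^T).
  by rewrite /A' mulmxBl mul1mx -mulmxA hu' -scalemxAr.
have A'E2 : A' = Q *m A *m Q.
  rewrite -/A' mulmxBr mulmx1 mulmxA /A' -(mulmxA Q A u) hu -scalemxAr Qu.
  by rewrite scaler0 mul0mx subr0.
have pA' : psd A'.
  apply/psd_dot; split=> [|w]; first by rewrite A'E2 !trmx_mul sA sQ mulmxA.
  by rewrite A'E2 -!mulmxA dot_adj sQ qA.
have A'u : A' *m u = 0 by rewrite /A' -mulmxA hu -scalemxAr Qu scaler0.
have rA' : (\rank A' < r)%N.
  apply: leq_trans (_ : \rank A <= r)%N; last by rewrite -ltnS.
  apply: rank_ltmx; rewrite ltmxE submxMl /=; apply/negP => sAA'.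
  have : (u^T <= A')%MS.
    apply: submx_trans sAA'; apply/submxP; exists (mu^-1 *: u^T).
    by rewrite -scalemxAl hu' scalerA mulVf ?scale1r // gt_eqF.
  move=> /submxP[w hw].
  have : u^T *m u = 0 by rewrite hw -mulmxA A'u mulmx0.
  by rewrite uu => /matrixP/(_ 0 0); rewrite !mxE eqxx => /eqP; rewrite oner_eq0.
have [S [pS SS]] := IH A' rA' pA'; have /psd_dot[sS qS] := pS.
have Su : S *m u = 0.
  by apply/eqP; rewrite -dot_eq0 -(dot_sym u _ sS) mulmxA SS A'u dot0r.
have uS : u^T *m S = 0 by rewrite -{1}sS -trmx_mul Su trmx0.
exists (S + Num.sqrt mu *: (u *m u^T)); split.
  apply/psd_dot; split=> [|w]; first by rewrite linearD linearZ /= trmx_mul trmxK sS.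
  rewrite mulmxDl dotDr -scalemxAl dotZr addr_ge0 ?qS // mulr_ge0 ?sqrtr_ge0 //.
  by rewrite -mulmxA dot_adj dot_ge0.
rewrite mulmxDl !mulmxDr SS -!scalemxAl -!scalemxAr !mulmxA Su mul0mx scaler0 addr0.
rewrite -(mulmxA u u^T S) uS mulmx0 scaler0 add0r -(mulmxA u u^T u) uu mulmx1.
rewrite scalerA -expr2.
by rewrite sqr_sqrtr ?ltW // A'E subrK.
Qed.

Lemma sqrtmxP n (A : 'M[R]_n) : psd A -> psd (sqrtmx A) /\ sqrtmx A *m sqrtmx A = A.
Proof. by move=> pA; exact: (xgetPex 0 (psd_sqrt_exists pA)). Qed.

Lemma unitmx_inj n (A : 'M[R]_n) : (forall v : 'cV_n, A *m v = 0 -> v = 0) -> A \in unitmx.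
Proof.
move=> h; rewrite -unitmx_tr -row_free_unit -kermx_eq0.
apply/eqP/row_matrixP => i; rewrite row0; apply: trmx_inj; rewrite trmx0.
by apply: h; apply: trmx_inj; rewrite trmx_mul trmxK trmx0 -row_mul mulmx_ker row0.
Qed.

(** At [sqrt M x], the Rayleigh bound for the whitened matrix becomes a comparison
    of [Q] with [M]. *)
Lemma lambda_max_whitened n (M Q : 'M[R]_n) x : M^T = M -> Q^T = Q ->
  0 < lambda_min M ->
  dot x (Q *m x) <= lambda_max (invsqrtmx M *m Q *m invsqrtmx M) * dot x (M *m x).
Proof.
move=> sM sQ l0.
have pM : psd M.
  apply/psd_dot; split=> // v; apply: le_trans (lambda_min_le v sM).
  by rewrite mulr_ge0 ?dot_ge0 // ltW.
have [/psd_dot[sS qS] SS] := sqrtmxP pM; rewrite /invsqrtmx.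
set S := sqrtmx M in sS qS SS *.
have uS : S \in unitmx.
  apply: unitmx_inj => v Sv; apply/eqP; rewrite -dot_eq0 eq_le dot_ge0 andbT.
  rewrite -(ler_pM2l l0) mulr0 (le_trans (lambda_min_le v sM)) //.
  by rewrite -SS -mulmxA Sv mulmx0 dot0r.
have sI : (invmx S)^T = invmx S by rewrite trmx_inv sS.
have sW : (invmx S *m Q *m invmx S)^T = invmx S *m Q *m invmx S.
  by rewrite !trmx_mul sI sQ mulmxA.
have := lambda_max_ge (S *m x) sW.
by rewrite -SS -!mulmxA mulKmx // dot_adj sI mulKmx // (dot_adj S x) sS.
Qed.

Lemma dot_le_enorm n (u v : 'cV[R]_n) : dot u v <= enorm u * enorm v.
Proof.
rewrite (le_trans (ler_norm _)) // -(@ler_pXn2r _ 2) ?nnegrE ?mulr_ge0 ?enorm_ge0 //.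
by rewrite exprMn !enorm_sqr real_normK ?num_real // cauchy_schwarz.
Qed.

Lemma opnorm_ge n (A : 'M[R]_n) v : dot v (A *m v) <= opnorm A * dot v v.
Proof.
have [->|v0] := eqVneq v 0; first by rewrite mulmx0 dot0r mulr0.
have [C C0 hC] := mulmx_bounded A.
have e0 : enorm v != 0 by rewrite -sqrf_eq0 enorm_sqr dot_eq0.
pose w := (enorm v)^-1 *: v.
have w1 : dot w w = 1.
  by rewrite /w dotZl dotZr -enorm_sqr; field.
have ew : enorm w = 1.
  by apply/eqP; rewrite -(@eqrXn2 _ 2) ?enorm_ge0 // enorm_sqr w1 expr1n.
have hop : enorm (A *m w) <= opnorm A.
  apply: sup_ubound; last by exists w => //=; rewrite ew.
  exists (Num.sqrt C) => _ [t /= t1 <-].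
  rewrite -(@ler_pXn2r _ 2) ?nnegrE ?sqrtr_ge0 ?enorm_ge0 //.
  rewrite enorm_sqr (sqr_sqrtr (ltW C0)) (le_trans (hC t)) //.
  by rewrite ger_pMr // -enorm_sqr expr_le1 // enorm_ge0.
have -> : dot v (A *m v) = dot w (A *m w) * enorm v ^+ 2.
  by rewrite /w -scalemxAr dotZl dotZr; field.
rewrite -enorm_sqr.
rewrite ler_wpM2r ?sqr_ge0 // (le_trans (dot_le_enorm _ _)) //.
by rewrite ew mul1r.
Qed.

(** The two Gram matrices are conjugate through [B]. *)
Lemma lambda_min_gram_eq n (B : 'M[R]_n) : B \in unitmx ->
  lambda_min (B^T *m B) = lambda_min (B *m B^T).
Proof.
move=> uB; have uBT : B^T \in unitmx by rewrite unitmx_tr.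
rewrite /lambda_min; congr inf; apply/seteqP; split=> a /= /eigenvalueP[v hv v0];
  apply/eigenvalueP.
  exists (v *m B^T).
    by rewrite scalemxAl -hv !mulmxA.
  by apply: contra v0 => /eqP h; rewrite -(mulmxK uBT v) h mul0mx.
exists (v *m B).
  by rewrite scalemxAl -hv !mulmxA.
by apply: contra v0 => /eqP h; rewrite -(mulmxK uB v) h mul0mx.
Qed.

Lemma lambda_min_le_max n (A : 'M[R]_n) : (0 < n)%N -> A^T = A -> lambda_min A <= lambda_max A.
Proof.
move=> n0 sA; have [/(eigenvalue_dot sA)[v v0 hv] _] := lambda_min_spec n0 sA.
by have := lambda_max_ge v sA; rewrite hv dotZr ler_pM2r ?dot_gt0.
Qed.

End symmetric_matrices.

(** * Square integrable and independent random variables *)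

Section square_integrable.
Context d (Omega : measurableType d) (R : realType) (P : probability Omega R).

(** Membership in L^2, stated with the square itself so that it applies directly
    to entries of random matrices with integrable Gram matrices. *)
Definition sqint (f : Omega -> R) : Prop :=
  measurable_fun setT f /\ P.-integrable setT (fun w => (f w ^+ 2)%:E).

Lemma fine_expect (f : Omega -> R) : fine 'E_P[f]%E = \int[P]_w f w.
Proof. by rewrite unlock. Qed.

Lemma sqint_cst (c : R) : sqint (fun=> c).
Proof.
split=> //; exact: (finite_measure_integrable_cst P (c ^+ 2) measurableT).
Qed.

Lemma sqint_mul f g : sqint f -> sqint g -> P.-integrable setT (fun w => (f w * g w)%:E).
Proof.
move=> [mf sf] [mg sg].
apply: (@le_integrable _ _ _ P setT _ _ (fun w => (f w ^+ 2 + g w ^+ 2)%:E)) => //.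
- by apply/measurable_EFinP; exact: measurable_funM.
- move=> w _; rewrite /= lee_fin [leRHS]ger0_norm ?addr_ge0 ?sqr_ge0 //.
  by rewrite ler_norml; nra.
- by have := integrableD measurableT sf sg; apply: eq_integrable.
Qed.

Lemma sqint_integrable f : sqint f -> P.-integrable setT (fun w => (f w)%:E).
Proof.
move=> sf; have := sqint_mul sf (sqint_cst 1).
by apply: eq_integrable => // w _; rewrite mulr1.
Qed.

Lemma sqintD f g : sqint f -> sqint g -> sqint (fun w => f w + g w).
Proof.
move=> sf sg; have fg := sqint_mul sf sg; case: sf sg => [mf sf] [mg sg].
split; first exact: measurable_funD.
have := integrableD measurableT (integrableD measurableT sf sg)
  (integrableD measurableT fg fg).
by apply: eq_integrable => // w _; rewrite /= -!EFinD; congr EFin; ring.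
Qed.

Lemma sqintZ c f : sqint f -> sqint (fun w => c * f w).
Proof.
move=> [mf sf]; split; first by apply: measurable_funM => //; exact: measurable_cst.
have := integrableZl measurableT (c ^+ 2) sf.
by apply: eq_integrable => // w _; rewrite /= -EFinM exprMn.
Qed.

Lemma integrable_sumr I (r : seq I) (F : I -> Omega -> R) :
  (forall i, P.-integrable setT (fun w => (F i w)%:E)) ->
  P.-integrable setT (fun w => (\sum_(i <- r) F i w)%:E).
Proof.
move=> h; elim: r => [|a r IH].
  under eq_fun do rewrite big_nil.
  exact: (finite_measure_integrable_cst P 0 measurableT).
under eq_fun do rewrite big_cons EFinD.
exact: integrableD.
Qed.

Lemma sqint_sum I (r : seq I) (F : I -> Omega -> R) :
  (forall i, sqint (F i)) -> sqint (fun w => \sum_(i <- r) F i w).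
Proof.
move=> h; elim: r => [|a r IH].
  under eq_fun do rewrite big_nil; exact: sqint_cst.
under eq_fun do rewrite big_cons; exact: sqintD.
Qed.

Lemma Rintegral_prob_cst (c : R) : \int[P]_w c = c.
Proof.
have P1 : fine (P setT) = 1 by rewrite (probability_setT P).
by rewrite Rintegral_cst // P1 mulr1.
Qed.

Lemma Rintegral_sumr I (r : seq I) (F : I -> Omega -> R) :
  (forall i, P.-integrable setT (fun w => (F i w)%:E)) ->
  \int[P]_w (\sum_(i <- r) F i w) = \sum_(i <- r) \int[P]_w F i w.
Proof.
move=> h; elim: r => [|a r IH].
  under eq_Rintegral do rewrite big_nil.
  by rewrite big_nil Rintegral_prob_cst.
under eq_Rintegral do rewrite big_cons.
by rewrite big_cons RintegralD ?IH //; [exact: h|exact: integrable_sumr].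
Qed.

End square_integrable.

Section independent_product.
Context d (Omega : measurableType d) (R : realType) (P : probability Omega R).
Variables U V : Omega -> R.
Hypotheses (mU : measurable_fun setT U) (mV : measurable_fun setT V).
Hypothesis indUV : independent2 P U V.

Let fU : {mfun Omega >-> R} := HB.pack U (isMeasurableFun.Build _ _ _ _ _ mU).
Let fV : {mfun Omega >-> R} := HB.pack V (isMeasurableFun.Build _ _ _ _ _ mV).
Let UV (w : Omega) : R * R := (U w, V w).
Let mUV : measurable_fun setT UV.
Proof. exact: measurable_fun_pair. Qed.
Let fUV : {mfun Omega >-> (R * R)%type} := HB.pack UV (isMeasurableFun.Build _ _ _ _ _ mUV).

Let joint_law A : measurable A ->
  (distribution P fU \x distribution P fV)%E A = distribution P fUV A.
Proof.
move=> mA; have h A' B' : measurable A' -> measurable B' ->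
    distribution P fUV (A' `*` B') = (distribution P fU A' * distribution P fV B')%E.
  by move=> mA' mB'; rewrite /distribution /= /pushforward /= -indUV.
exact: (product_measure_unique (m1 := distribution P fU) (m2 := distribution P fV)
   (m' := distribution P fUV) h).
Qed.

Let mmul : measurable_fun setT (fun p : R * R => (p.1 * p.2)%:E).
Proof.
by apply/measurable_EFinP; apply: measurable_funM; [exact: measurable_fst|exact: measurable_snd].
Qed.

Hypothesis iU : P.-integrable setT (fun w => (U w)%:E).
Hypothesis iV : P.-integrable setT (fun w => (V w)%:E).

Let iU' : (distribution P fU).-integrable setT (fun x : R => x%:E).
Proof.
apply: (integrable_pushforward mU (f := EFin) _ iU measurableT).
by apply/measurable_EFinP; exact: measurable_id.
Qed.

Let iV' : (distribution P fV).-integrable setT (fun x : R => x%:E).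
Proof.
apply: (integrable_pushforward mV (f := EFin) _ iV measurableT).
by apply/measurable_EFinP; exact: measurable_id.
Qed.

Let mabs : measurable_fun setT (fun x : R => `|x|%:E).
Proof. by apply/measurable_EFinP; exact: normr_measurable. Qed.

Let iprod : (distribution P fU \x distribution P fV)%E.-integrable setT
  (fun p : R * R => (p.1 * p.2)%:E).
Proof.
apply/integrable12ltyP => //.
rewrite (eq_integral (fun x : R =>
    (`|x|%:E * (\int[distribution P fV]_y `|y|%:E))%E)); last first.
  move=> x _; under eq_integral => y _ do rewrite /= normrM EFinM.
  by rewrite ge0_integralZl.
have [mV' fV'] := integrableP _ _ _ iV'; have [mU' fU'] := integrableP _ _ _ iU'.
rewrite ge0_integralZr //.
- by rewrite lte_mul_pinfty // ?integral_ge0 // ge0_fin_numE // integral_ge0.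
- by apply: integral_ge0.
Qed.

(** The law of the pair is the product of the two laws, and Tonelli factors the
    integral of [|u v|] against it. *)
Lemma indep_integrableM : P.-integrable setT (fun w => (U w * V w)%:E).
Proof.
have [_ h] := integrableP _ _ _ iprod.
apply/integrableP; split.
  by apply/measurable_EFinP; exact: measurable_funM.
apply: le_lt_trans h.
rewrite (eq_measure_integral (distribution P fUV)); last by move=> A mA _; exact: joint_law.
rewrite ge0_integral_pushforward //=.
exact: (measurableT_comp mabs (measurable_funM measurable_fst measurable_snd)).
Qed.

Lemma indep_integralM :
  \int[P]_w (U w * V w) = (\int[P]_w U w) * (\int[P]_w V w).
Proof.
have := integral12_prod_meas1 iprod.
rewrite (eq_measure_integral (distribution P fUV)); last by move=> A mA _; exact: joint_law.
rewrite (integral_distribution (X := fUV) mmul indep_integrableM).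
move=> /(congr1 fine); rewrite -[RHS]/(\int[P]_w (U w * V w)) => <-.
rewrite (eq_integral (fun x : R =>
    (x%:E * (\int[distribution P fV]_y y%:E))%E)); last first.
  move=> x _; rewrite /fubini_F; under eq_integral => y _ do rewrite /= EFinM.
  by rewrite integralZl.
have mE : measurable_fun setT (EFin : R -> \bar R).
  by apply/measurable_EFinP; exact: measurable_id.
have -> : (\int[distribution P fV]_y y%:E)%E = (\int[P]_x V x)%:E.
  by rewrite (integral_distribution (X := fV) mE iV) fineK // (integrable_fin_num _ iV).
rewrite integralZr //.
have -> : (\int[distribution P fU]_y y%:E)%E = (\int[P]_x U x)%:E.
  by rewrite (integral_distribution (X := fU) mE iU) fineK // (integrable_fin_num _ iU).
by [].
Qed.

End independent_product.

(** * The past of an i.i.d. sequence *)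

Section filtration.
Context d (Omega : measurableType d) (R : realType) (P : probability Omega R).
Context d' (T : measurableType d') (X : nat -> {RV P >-> T}).
Hypothesis indX : independent_family P [set t | (1 <= t)%N] (fun t => X t : Omega -> T).

(** The finite intersections of events of single samples: a pi-system that
    generates the sigma-algebra of the first [t] samples.  Taking [A i = setT]
    leaves sample [i] free. *)
Definition cylinder t : set (set Omega) :=
  [set \bigcap_(i in [set i | (1 <= i <= t)%N]) X i @^-1` A i
     | A in [set A | forall i, measurable (A i)]].

(** The sample space with this sigma-algebra, so that measurability with respect
    to the past is measurability of a function on [past t]. *)
Definition past t := g_sigma_algebraType (cylinder t).

Definition adapted t (f : Omega -> R) : Prop :=
  measurable_fun (setT : set (past t)) (f : past t -> R).

Lemma cylinder_measurable t : cylinder t `<=` measurable.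
Proof.
move=> _ [A mA <-]; apply: fin_bigcap_measurable.
  by apply: (@sub_finite_set _ _ `I_t.+1) => // i /= /andP[_]; rewrite ltnS.
by move=> i _; rewrite -[X in measurable X]setTI; exact: measurable_funP.
Qed.

Lemma past_measurable t : <<s cylinder t >> `<=` measurable.
Proof.
by apply: smallest_sub; [exact: sigma_algebra_measurable|exact: cylinder_measurable].
Qed.

Lemma cylinderT t : cylinder t setT.
Proof.
by exists (fun=> setT) => //; rewrite -subTset => w _ i _.
Qed.

Lemma cylinderI t : setI_closed (cylinder t).
Proof.
move=> _ _ [A mA <-] [C mC <-]; exists (fun i => A i `&` C i).
  by move=> i; exact: measurableI.
by rewrite -bigcapI; apply: eq_bigcapr => i _; rewrite preimage_setI.
Qed.

Lemma cylinder_sub t : cylinder t `<=` cylinder t.+1.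
Proof.
move=> _ [A mA <-]; exists (fun i => if (i <= t)%N then A i else setT).
  by move=> i; case: ifP.
apply/seteqP; split=> w h i /= /andP[i1 it].
  by have := h i; rewrite /= it i1 (leq_trans it) //; apply.
case: ifP => // it'; apply: h; rewrite /= i1 it' //.
Qed.

Lemma cylinder_last t C : measurable C -> cylinder t.+1 (X t.+1 @^-1` C).
Proof.
move=> mC; exists (fun i => if i == t.+1 then C else setT).
  by move=> i; case: ifP.
apply/seteqP; split=> w h; first by have := h t.+1; rewrite /= eqxx leqnn; apply.
by move=> i /= _; case: eqP => // ->.
Qed.

Lemma adapted_measurable t f : adapted t f -> measurable_fun (setT : set Omega) f.
Proof.
by move=> af _ Y mY; apply: (@past_measurable t); exact: (af measurableT Y mY).
Qed.

Lemma adapted_sub t f : adapted t f -> adapted t.+1 f.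
Proof.
move=> af _ Y mY; have := af measurableT Y mY.
by apply: sub_sigma_algebra2; exact: cylinder_sub.
Qed.

Lemma adapted_last t (a : T -> R) : measurable_fun setT a ->
  adapted t.+1 (fun w => a (X t.+1 w)).
Proof.
move=> ma _ Y mY; rewrite setTI; apply: sub_sigma_algebra.
rewrite (_ : (fun _ => _) @^-1` Y = X t.+1 @^-1` (a @^-1` Y)) //.
by apply: cylinder_last; rewrite -[X in measurable X]setTI; exact: ma.
Qed.

Lemma cylinder_indep t E C : cylinder t E -> measurable C ->
  P (E `&` X t.+1 @^-1` C) = (P E * P (X t.+1 @^-1` C))%E.
Proof.
move=> [A mA <-] mC.
pose J := [fset i in iota 1 t]%fset.
have JE i : (i \in J) = (1 <= i <= t)%N by rewrite !inE mem_iota add1n ltnS.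
have tJ : t.+1 \notin J by rewrite JE ltnn andbF.
pose A' i := if i == t.+1 then C else A i.
have mA' i : measurable (A' i) by rewrite /A'; case: ifP.
have A'E i : i \in J -> A' i = A i.
  by move=> iJ; rewrite /A'; case: eqP => // h; move: iJ; rewrite h (negbTE tJ).
have J1 : [set` J] `<=` [set t | (1 <= t)%N] by move=> i /=; rewrite JE => /andP[].
have J1' : [set` (t.+1 |` J)%fset] `<=` [set t | (1 <= t)%N].
  by move=> i /=; rewrite in_fset1U => /orP[/eqP->//|]; exact: J1.
have capE : \bigcap_(i in [set i | (1 <= i <= t)%N]) X i @^-1` A i =
    \bigcap_(i in [set` J]) X i @^-1` A' i.
  by apply/seteqP; split=> w h i /=; [move=> iJ; rewrite A'E //; apply: h; rewrite /= -JE
    |rewrite -JE => iJ; rewrite -A'E //; exact: h].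
have -> : (\bigcap_(i in [set i | (1 <= i <= t)%N]) X i @^-1` A i) `&` X t.+1 @^-1` C =
    \bigcap_(i in [set` (t.+1 |` J)%fset]) X i @^-1` A' i.
  rewrite capE; apply/seteqP; split=> w.
    move=> [h hC] i /=; rewrite in_fset1U => /orP[/eqP->|]; last exact: h.
    by rewrite /A' eqxx.
  move=> h; split; first by move=> i iJ; apply: h; rewrite /= in_fset1U (iJ : i \in J) orbT.
  by have := h t.+1; rewrite /= in_fset1U eqxx /A' eqxx; apply.
rewrite indX // big_fsetU1 //= capE indX // muleC.
by rewrite /A' eqxx.
Qed.

(** Both sides are finite measures in [E] that agree on the pi-system of
    cylinders, hence on the sigma-algebra it generates. *)
Lemma past_indep t E C : <<s cylinder t >> E -> measurable C ->
  P (E `&` X t.+1 @^-1` C) = (P E * P (X t.+1 @^-1` C))%E.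
Proof.
move=> tE mC; set D := X t.+1 @^-1` C.
have mD : measurable D by rewrite -[D]setTI; exact: measurable_funP.
have PD : P D = (fine (P D))%:E by rewrite fineK // fin_num_measure.
have PD0 : (0 <= fine (P D))%R by rewrite fine_ge0.
pose m1 := mrestr P mD; pose m2 := mscale (NngNum PD0) P.
rewrite -[LHS]/(m1 E) muleC PD -[RHS]/(m2 E).
apply: (g_sigma_algebra_measure_unique _ (@cylinder_measurable t) (fun=> setT)) tE => //.
- by move=> i; exact: cylinderT.
- by rewrite bigcup_const //; exists 0%N.
- exact: cylinderI.
- by move=> E' cE'; rewrite /= /mrestr /mscale /= cylinder_indep // muleC -PD.
- by move=> k; rewrite /= /mrestr setTI -ge0_fin_numE // fin_num_measure.
Qed.

Lemma adapted_indep t f (a : T -> R) : adapted t f -> measurable_fun setT a ->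
  independent2 P (fun w => a (X t.+1 w)) f.
Proof.
move=> af ma A C mA mC; rewrite setIC muleC.
have -> : (fun w => a (X t.+1 w)) @^-1` A = X t.+1 @^-1` (a @^-1` A) by [].
rewrite past_indep //.
  by have := af measurableT C mC; rewrite setTI.
by rewrite -[X in measurable X]setTI; exact: ma.
Qed.

Lemma adaptedD t f g : adapted t f -> adapted t g -> adapted t (fun w => f w + g w).
Proof. exact: measurable_funD. Qed.

Lemma adaptedM t f g : adapted t f -> adapted t g -> adapted t (fun w => f w * g w).
Proof. exact: measurable_funM. Qed.

Lemma adapted_cst t c : adapted t (fun=> c).
Proof. exact: measurable_cst. Qed.

Lemma adapted_sum t I (r : seq I) (F : I -> Omega -> R) :
  (forall i, adapted t (F i)) -> adapted t (fun w => \sum_(i <- r) F i w).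
Proof. exact: measurable_sum. Qed.

Section identically_distributed.
Context d0 (Omega0 : measurableType d0) (P0 : probability Omega0 R) (xi : {RV P0 >-> T}).
Hypothesis lawX : forall t, (1 <= t)%N -> forall A, measurable A ->
  distribution P (X t) A = distribution P0 xi A.

Lemma integrable_law t (a : T -> \bar R) : measurable_fun setT a -> (1 <= t)%N ->
  P0.-integrable setT (fun w => a (xi w)) -> P.-integrable setT (fun w => a (X t w)).
Proof.
move=> ma t1 /integrableP[_ ia]; apply/integrableP; split.
  by apply: (measurableT_comp ma).
have mabs : measurable_fun setT (fun x => `|a x|%E) by exact: measurableT_comp.
have E := ge0_integral_pushforward (measurable_funPT (X t)) P measurableT mabs
  (fun _ _ => abse_ge0 _).
have E0 := ge0_integral_pushforward (measurable_funPT xi) P0 measurableT mabs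
  (fun _ _ => abse_ge0 _).
apply: le_lt_trans ia; rewrite -[leLHS]E -[leRHS]E0.
by rewrite (eq_measure_integral (distribution P0 xi)) // => A mA _; exact: lawX.
Qed.

Lemma integral_law t (a : T -> \bar R) : measurable_fun setT a -> (1 <= t)%N ->
  P0.-integrable setT (fun w => a (xi w)) ->
  (\int[P]_w a (X t w) = \int[P0]_w a (xi w))%E.
Proof.
move=> ma t1 ia; have iX := integrable_law ma t1 ia.
rewrite -(integral_distribution (X := xi) ma ia) -(integral_distribution (X := X t) ma iX).
by apply: eq_measure_integral => A mA _; exact: lawX.
Qed.

Lemma Rintegral_law t (a : T -> R) : measurable_fun setT a -> (1 <= t)%N ->
  P0.-integrable setT (fun w => (a (xi w))%:E) ->
  \int[P]_w a (X t w) = \int[P0]_w a (xi w).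
Proof.
move=> ma t1 ia; congr fine; apply: (integral_law (a := fun x => (a x)%:E)) => //.
exact/measurable_EFinP.
Qed.

Lemma integrable_fresh t f (a : T -> R) : adapted t f -> measurable_fun setT a ->
  P.-integrable setT (fun w => (f w)%:E) -> P0.-integrable setT (fun w => (a (xi w))%:E) ->
  P.-integrable setT (fun w => (a (X t.+1 w) * f w)%:E).
Proof.
move=> af ma If Ia; apply: indep_integrableM => //.
- exact: (measurableT_comp ma).
- exact: adapted_measurable af.
- exact: adapted_indep.
- by apply: (integrable_law (a := fun x => (a x)%:E)) => //; exact/measurable_EFinP.
Qed.

Lemma Rintegral_fresh t f (a : T -> R) : adapted t f -> measurable_fun setT a ->
  P.-integrable setT (fun w => (f w)%:E) -> P0.-integrable setT (fun w => (a (xi w))%:E) ->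
  \int[P]_w (a (X t.+1 w) * f w) = (\int[P0]_w a (xi w)) * \int[P]_w f w.
Proof.
move=> af ma If Ia; rewrite indep_integralM ?(Rintegral_law ma _ Ia) //.
- exact: (measurableT_comp ma).
- exact: adapted_measurable af.
- exact: adapted_indep.
- by apply: (integrable_law (a := fun x => (a x)%:E)) => //; exact/measurable_EFinP.
Qed.

Lemma sqint_fresh t f (a : T -> R) : adapted t f -> measurable_fun setT a ->
  sqint P f -> sqint P0 (fun w => a (xi w)) -> sqint P (fun w => a (X t.+1 w) * f w).
Proof.
move=> af ma [mf sf] [_ sa]; split.
  by apply: measurable_funM => //; exact: (measurableT_comp ma).
under eq_fun do rewrite exprMn.
apply: (integrable_fresh (f := fun w => f w ^+ 2) (a := fun x => a x ^+ 2)) => //.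
  exact: measurable_funX.
exact: measurable_funX.
Qed.

End identically_distributed.

End filtration.

(** * Averages of a random linear recursion *)

Section random_vectors.
Context d (Omega : measurableType d) (R : realType) (P : probability Omega R).

Definition sqvec n (W : Omega -> 'cV[R]_n) : Prop := forall i, sqint P (fun w => W w i 0).

Lemma sqvec_cst n (z : 'cV[R]_n) : sqvec (fun=> z).
Proof. by move=> i; exact: sqint_cst. Qed.

Lemma sqvec_mulmx n m (A : 'M[R]_(m, n)) W : sqvec W -> sqvec (fun w => A *m W w).
Proof.
move=> sW i; under eq_fun do rewrite mxE.
by apply: sqint_sum => j; exact: sqintZ.
Qed.

Lemma sqvecZ n c (W : Omega -> 'cV[R]_n) : sqvec W -> sqvec (fun w => c *: W w).
Proof. by move=> sW i; under eq_fun do rewrite mxE; exact: sqintZ. Qed.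

Lemma sqvec_sum I n (r : seq I) (F : I -> Omega -> 'cV[R]_n) :
  (forall i, sqvec (F i)) -> sqvec (fun w => \sum_(i <- r) F i w).
Proof.
move=> h j; under eq_fun do rewrite summxE.
by apply: sqint_sum => i; exact: h.
Qed.

Lemma integrable_dot n (U V : Omega -> 'cV[R]_n) : sqvec U -> sqvec V ->
  P.-integrable setT (fun w => (dot (U w) (V w))%:E).
Proof.
move=> sU sV; under eq_fun do rewrite dotE.
by apply: integrable_sumr => i; exact: sqint_mul.
Qed.

Definition mean_sq n (W : Omega -> 'cV[R]_n) : R := \int[P]_w dot (W w) (W w).

Lemma Rintegral_dotZ n c (U V : Omega -> 'cV[R]_n) : sqvec U -> sqvec V ->
  \int[P]_w (c * dot (U w) (V w)) = c * \int[P]_w dot (U w) (V w).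
Proof. by move=> sU sV; rewrite RintegralZl //; exact: integrable_dot. Qed.

End random_vectors.

Section adapted_vectors.
Context d (Omega : measurableType d) (R : realType) (P : probability Omega R).
Context d' (T : measurableType d') (X : nat -> {RV P >-> T}).
Hypothesis indX : independent_family P [set t | (1 <= t)%N] (fun t => X t : Omega -> T).
Context d0 (Omega0 : measurableType d0) (P0 : probability Omega0 R) (xi : {RV P0 >-> T}).
Hypothesis lawX : forall t, (1 <= t)%N -> forall A, measurable A ->
  distribution P (X t) A = distribution P0 xi A.

Definition advec t n (W : Omega -> 'cV[R]_n) : Prop :=
  forall i, adapted X t (fun w => W w i 0).

Lemma advec_cst t n (z : 'cV[R]_n) : advec t (fun=> z).
Proof. by move=> i; exact: adapted_cst. Qed.

Lemma advecD t n (U V : Omega -> 'cV[R]_n) :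
  advec t U -> advec t V -> advec t (fun w => U w + V w).
Proof. by move=> sU sV i; under eq_fun do rewrite mxE; exact: adaptedD. Qed.

Lemma advecZ t n c (W : Omega -> 'cV[R]_n) : advec t W -> advec t (fun w => c *: W w).
Proof.
by move=> sW i; under eq_fun do rewrite mxE; apply: adaptedM => //; exact: adapted_cst.
Qed.

Lemma advec_sub t n (W : Omega -> 'cV[R]_n) : advec t W -> advec t.+1 W.
Proof. by move=> aW i; exact: adapted_sub. Qed.

Lemma advec_subn s t n (W : Omega -> 'cV[R]_n) : (s <= t)%N -> advec s W -> advec t W.
Proof.
move=> /subnK <-; elim: (t - s)%N => [|k IH] //.
by move=> h; rewrite addSn; apply: advec_sub; exact: IH.
Qed.

Lemma advec_fresh t n m (F : T -> 'M[R]_(m, n)) W :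
  (forall i j, measurable_fun setT (fun x => F x i j)) ->
  advec t W -> advec t.+1 (fun w => F (X t.+1 w) *m W w).
Proof.
move=> mF aW i; under eq_fun do rewrite mxE.
apply: adapted_sum => j; apply: adaptedM; last exact: adapted_sub.
exact: (adapted_last (a := fun x => F x i j)).
Qed.

Lemma sqvec_fresh t n m (F : T -> 'M[R]_(m, n)) W :
  (forall i j, measurable_fun setT (fun x => F x i j)) ->
  (forall i j, sqint P0 (fun w => F (xi w) i j)) ->
  advec t W -> sqvec P W -> sqvec P (fun w => F (X t.+1 w) *m W w).
Proof.
move=> mF sF aW sW i; under eq_fun do rewrite mxE.
by apply: sqint_sum => j; apply: (sqint_fresh indX lawX (a := fun x => F x i j)).
Qed.

(** Expand the form into entries: each entry of the fresh matrix is independent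
    of the product of the two past coordinates it is multiplied by. *)
Lemma Rintegral_fresh_form t n m (F : T -> 'M[R]_(m, n)) U W :
  (forall i j, measurable_fun setT (fun x => F x i j)) ->
  mx_integrable P0 (fun w => F (xi w)) ->
  advec t U -> advec t W -> sqvec P U -> sqvec P W ->
  \int[P]_w dot (U w) (F (X t.+1 w) *m W w)
  = \int[P]_w dot (U w) (Emx P0 (fun w => F (xi w)) *m W w).
Proof.
move=> mF iF aU aW sU sW.
have E (G : Omega -> 'M[R]_(m, n)) : (fun w => dot (U w) (G w *m W w)) =
    fun w => \sum_(p : 'I_m * 'I_n) G w p.1 p.2 * (U w p.1 0 * W w p.2 0).
  apply/funext => w; rewrite dotE -(pair_bigA _ (fun i j => G w i j * (U w i 0 * W w j 0))) /=.
  apply: eq_bigr => i _; rewrite mxE big_distrr /=; apply: eq_bigr => j _; ring.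
rewrite !E !Rintegral_sumr.
- apply: eq_bigr => -[i j] _ /=.
  have af : adapted X t (fun w => U w i 0 * W w j 0) by exact: adaptedM.
  have intf : P.-integrable setT (fun w => (U w i 0 * W w j 0)%:E) by exact: sqint_mul.
  rewrite (Rintegral_fresh indX lawX af (a := fun x => F x i j)) //.
  by rewrite RintegralZl // mxE fine_expect.
- move=> [i j] /=; under eq_fun do rewrite EFinM; apply: integrableZl => //.
  exact: sqint_mul.
- move=> [i j] /=; apply: (integrable_fresh indX lawX (a := fun x => F x i j)) => //.
    exact: adaptedM.
  exact: sqint_mul.
Qed.

End adapted_vectors.

Section scalar_inequalities.
Context {R : realType}.

(** Cauchy-Schwarz with weights [1], [1], [q]; the defect is the sum of the
    weighted squares of the pairwise differences. *)
Lemma dot_sum3_le n (a b e : 'cV[R]_n) q : 0 < q ->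
  dot (a - b - e) (a - b - e) <= (2 + q) * (dot a a + dot b b + q^-1 * dot e e).
Proof.
move=> q0.
have h1 := dot_ge0 (a + b).
have h2 : 0 <= q * dot (a + q^-1 *: e) (a + q^-1 *: e) by rewrite mulr_ge0 ?dot_ge0 // ltW.
have h3 : 0 <= q * dot (b - q^-1 *: e) (b - q^-1 *: e) by rewrite mulr_ge0 ?dot_ge0 // ltW.
rewrite -subr_ge0.
have -> : (2 + q) * (dot a a + dot b b + q^-1 * dot e e) - dot (a - b - e) (a - b - e) =
    dot (a + b) (a + b) + q * dot (a + q^-1 *: e) (a + q^-1 *: e)
      + q * dot (b - q^-1 *: e) (b - q^-1 *: e).
  rewrite !(dotDr, dotDl, dotNr, dotNl, dotZr, dotZl) (dotC b a) (dotC e a) (dotC e b).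
  by field; rewrite gt_eqF.
by apply: addr_ge0 => //; exact: addr_ge0.
Qed.

(** The best weight is [q = s]; when [s = 0] it is only approached as [q] tends
    to [0]. *)
Lemma weighted_bound_opt (x y s : R) : 0 <= s -> 0 <= y ->
  (forall q, 0 < q -> x <= (2 + q) * (2 + q^-1 * s ^+ 2) * y) -> x <= (2 + s) ^+ 2 * y.
Proof.
move=> s0 y0 h; have [s00|sn0] := eqVneq s 0; last first.
  have sp : 0 < s by rewrite lt_neqAle eq_sym sn0.
  apply: le_trans (h s sp) _; rewrite le_eqVlt; apply/orP; left; apply/eqP.
  by field.
rewrite s00 addr0; apply/ler_addgt0Pr => e e0.
(* [y + 1] rather than [y], which may be zero *)
have yp : 0 < 2 * (y + 1) by lra.
have q0 : 0 < e / (2 * (y + 1)) by rewrite divr_gt0.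
have := h _ q0; rewrite s00 expr0n /= mulr0 addr0 => h1; apply: le_trans h1 _.
set q := e / _ in q0 *.
have -> : e = q * (2 * (y + 1)) by rewrite /q divfK // gt_eqF.
by nra.
Qed.

End scalar_inequalities.

Section epoch.
Context d (Omega : measurableType d) (R : realType) (P : probability Omega R).
Context d' (T : measurableType d') (X : nat -> {RV P >-> T}).
Hypothesis indX : independent_family P [set t | (1 <= t)%N] (fun t => X t : Omega -> T).
Context d0 (Omega0 : measurableType d0) (P0 : probability Omega0 R) (xi : {RV P0 >-> T}).
Hypothesis lawX : forall t, (1 <= t)%N -> forall A, measurable A ->
  distribution P (X t) A = distribution P0 xi A.
Context (N : nat) (F : T -> 'M[R]_N).
Hypothesis mF : forall i j, measurable_fun setT (fun x => F x i j).
Hypothesis sF : forall i j, sqint P0 (fun w => F (xi w) i j).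

Let H := Emx P0 (fun w => F (xi w)).
Notation sqn := (mean_sq P).

Variables v c : R.
Hypothesis nonexp : forall z,
  dot z (Emx P0 (fun w => (1%:M - F (xi w))^T *m (1%:M - F (xi w))) *m z) <= dot z z.
Hypothesis var : forall z,
  dot z (Emx P0 (fun w => (F (xi w) - H)^T *m (F (xi w) - H)) *m z) <= v * dot z z.
Hypothesis coer : forall z, c * dot z z <= dot (H *m z) (H *m z).

Variables (tau : nat) (Z : Omega -> 'cV[R]_N).
Hypotheses (aZ : advec X tau Z) (sZ : sqvec P Z).

(** The recursion z_s = (1 - F_(tau+s)) z_(s-1), started at time [tau] from a
    random vector [Z] of the past of [tau]. *)
Fixpoint trajectory (s : nat) (w : Omega) : 'cV[R]_N :=
  if s is s'.+1 then (1%:M - F (X (tau + s) w)) *m trajectory s' w else Z w.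

(** The part of the step from [s] to [s + 1] that the mean matrix misses. *)
Let noise s w := (F (X (tau + s).+1 w) - H) *m trajectory s w.

Let mIF i j : measurable_fun setT (fun x => (1%:M - F x) i j).
Proof.
under eq_fun do rewrite !mxE; apply: measurable_funB => //; exact: measurable_cst.
Qed.

Let mFH i j : measurable_fun setT (fun x => (F x - H) i j).
Proof.
by under eq_fun do rewrite !mxE; apply: measurable_funB => //; exact: measurable_cst.
Qed.

Let sIF i j : sqint P0 (fun w => (1%:M - F (xi w)) i j).
Proof.
under eq_fun do rewrite !mxE -mulN1r; apply: sqintD; first exact: sqint_cst.
exact: sqintZ.
Qed.

Let sFH i j : sqint P0 (fun w => (F (xi w) - H) i j).
Proof.
by under eq_fun do rewrite !mxE; apply: sqintD => //; exact: sqint_cst.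
Qed.

Lemma trajectory_advec s : advec X (tau + s) (trajectory s).
Proof.
elim: s => [|s IH]; first by rewrite addn0.
by rewrite addnS /=; under eq_fun do rewrite addnS; apply: (advec_fresh (F := fun x => 1%:M - F x)).
Qed.

Lemma trajectory_sqvec s : sqvec P (trajectory s).
Proof.
elim: s => [|s IH] //=; under eq_fun do rewrite addnS.
apply: (sqvec_fresh indX lawX (F := fun x => 1%:M - F x)) => //; exact: trajectory_advec.
Qed.

Let noise_advec s : advec X (tau + s).+1 (noise s).
Proof. by apply: (advec_fresh (F := fun x => F x - H)) => //; exact: trajectory_advec. Qed.

Let noise_sqvec s : sqvec P (noise s).
Proof.
by apply: (sqvec_fresh indX lawX (F := fun x => F x - H)) => //;
  [exact: trajectory_advec|exact: trajectory_sqvec].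
Qed.

(** The Gram matrix of a fresh matrix is replaced by its mean, to which the
    assumed bound applies pointwise. *)
Let gram_fresh (G : T -> 'M[R]_N) t W k :
  (forall i j, measurable_fun setT (fun x => G x i j)) ->
  (forall i j, sqint P0 (fun w => G (xi w) i j)) ->
  advec X t W -> sqvec P W ->
  (forall z, dot z (Emx P0 (fun w => (G (xi w))^T *m G (xi w)) *m z) <= k * dot z z) ->
  sqn (fun w => G (X t.+1 w) *m W w) <= k * sqn W.
Proof.
move=> mG sG aW sW h; rewrite /mean_sq.
under eq_Rintegral do rewrite dot_adj mulmxA dotC.
have mGG i j : measurable_fun setT (fun x => ((G x)^T *m G x) i j).
  under eq_fun do rewrite mxE.
  by apply: measurable_sum => l; under eq_fun do rewrite mxE; exact: measurable_funM.
have iGG : mx_integrable P0 (fun w => (G (xi w))^T *m G (xi w)).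
  move=> i j; under eq_fun do rewrite mxE.
  by apply: integrable_sumr => l; under eq_fun do rewrite mxE; exact: sqint_mul.
rewrite (Rintegral_fresh_form indX lawX (F := fun x => (G x)^T *m G x)) //.
rewrite -(Rintegral_dotZ _ sW sW); apply: le_Rintegral => //.
- by apply: integrable_dot => //; exact: sqvec_mulmx.
- have := integrableZl measurableT k (integrable_dot sW sW).
  by apply: eq_integrable => // w _; rewrite -EFinM.
Qed.

Lemma trajectory_le s : sqn (trajectory s) <= sqn Z.
Proof.
elim: s => [|s IH] //; apply: le_trans IH; rewrite -[leRHS]mul1r.
rewrite [X in sqn X](_ : _ = fun w => (1%:M - F (X (tau + s).+1 w)) *m trajectory s w); last first.
  by apply/funext => w; rewrite /= addnS.
apply: (gram_fresh (G := fun x => 1%:M - F x)) => //.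
- exact: trajectory_advec.
- exact: trajectory_sqvec.
- by move=> z; rewrite mul1r; exact: nonexp.
Qed.

Lemma noise_le s : 0 <= v -> sqn (noise s) <= v * sqn Z.
Proof.
move=> v0; apply: le_trans (ler_wpM2l v0 (trajectory_le s)).
apply: (gram_fresh (G := fun x => F x - H)) => //.
- exact: trajectory_advec.
- exact: trajectory_sqvec.
Qed.

Let mart k w := \sum_(1 <= s < k.+1) noise s w.

Let mart0 : mart 0 = fun=> 0.
Proof. by apply/funext => w; rewrite /mart big_geq. Qed.

Let martS k : mart k.+1 = fun w => mart k w + noise k.+1 w.
Proof. by apply/funext => w; rewrite /mart big_nat_recr. Qed.

Let mart_advec k : advec X (tau + k).+1 (mart k).
Proof.
elim: k => [|k IH]; first by rewrite mart0; exact: advec_cst.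
rewrite martS; apply: advecD; last exact: noise_advec.
by rewrite addnS; exact: advec_sub.
Qed.

Let mart_sqvec k : sqvec P (mart k).
Proof. by apply: sqvec_sum => s; exact: noise_sqvec. Qed.

Let centered : Emx P0 (fun w => F (xi w) - H) = 0.
Proof.
apply/matrixP => i j; rewrite !mxE fine_expect.
under eq_Rintegral do rewrite !mxE fine_expect.
rewrite RintegralB //; [|exact: sqint_integrable|exact: (finite_measure_integrable_cst P0)].
by rewrite Rintegral_prob_cst subrr.
Qed.

(** The increment is a fresh centered matrix applied to a vector of the past, and
    the martingale is such a vector too. *)
Let mart_orthogonal k : \int[P]_w dot (mart k w) (noise k.+1 w) = 0.
Proof.
rewrite (Rintegral_fresh_form indX lawX (F := fun x => F x - H)) //.
- rewrite centered; under eq_Rintegral do rewrite mul0mx dot0r.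
  by rewrite Rintegral_prob_cst.
- by move=> i j; exact: sqint_integrable.
- by rewrite addnS.
- exact: trajectory_advec.
- exact: trajectory_sqvec.
Qed.

Lemma mart_le k : 0 <= v -> sqn (mart k) <= k%:R * v * sqn Z.
Proof.
move=> v0; elim: k => [|k IH].
  rewrite !mul0r mart0 /mean_sq; under eq_Rintegral do rewrite dot0r.
  by rewrite Rintegral_prob_cst.
have -> : sqn (mart k.+1) = sqn (mart k) + 2 * \int[P]_w dot (mart k w) (noise k.+1 w)
    + sqn (noise k.+1).
  have imn : P.-integrable setT (fun w => (2 * dot (mart k w) (noise k.+1 w))%:E).
    have := integrableZl measurableT 2 (integrable_dot (mart_sqvec k) (noise_sqvec k.+1)).
    by apply: eq_integrable => // w _; rewrite -EFinM.
  have im := integrable_dot (mart_sqvec k) (mart_sqvec k).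
  have ino := integrable_dot (noise_sqvec k.+1) (noise_sqvec k.+1).
  rewrite /mean_sq martS -Rintegral_dotZ //.
  rewrite -RintegralD // -RintegralD //; last first.
    by have := integrableD measurableT im imn; apply: eq_integrable.
  apply: eq_Rintegral => w _; rewrite !dotDr !dotDl (dotC (noise _ _) (mart _ _)); ring.
rewrite mart_orthogonal mulr0 addr0 -natr1 2!mulrDl mul1r.
by apply: lerD => //; exact: noise_le.
Qed.

(** Each term is z_s - z_(s+1) minus a noise.  The sum starts at [1], so that
    it involves z_(k+1). *)
Lemma trajectory_telescope k w : H *m (\sum_(1 <= s < k.+1) trajectory s w) =
  trajectory 1 w - trajectory k.+1 w - mart k w.
Proof.
elim: k => [|k IH]; first by rewrite mart0 !big_geq // mulmx0 subrr subr0.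
have S : trajectory k.+2 w = trajectory k.+1 w - F (X (tau + k.+1).+1 w) *m trajectory k.+1 w.
  rewrite -addnS -[LHS]/((1%:M - F (X (tau + k.+2) w)) *m trajectory k.+1 w).
  by rewrite mulmxBl mul1mx.
rewrite big_nat_recr // mulmxDr [X in X + _]IH martS S /noise mulmxBl.
set o := trajectory k.+1 w; set f := F _ *m o.
by apply/colP => i; rewrite !mxE; ring.
Qed.

(** Both end points of the telescoped sum have mean square at most that of [Z],
    and the martingale at most [k v] times it; the three are combined with the
    best weights. *)
Lemma epoch_le k : 0 <= v ->
  c * sqn (fun w => \sum_(1 <= s < k.+1) trajectory s w) <=
  (2 + Num.sqrt (k%:R * v)) ^+ 2 * sqn Z.
Proof.
move=> v0; have kv0 : 0 <= k%:R * v by rewrite mulr_ge0.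
have Z0 : 0 <= sqn Z by apply: Rintegral_ge0 => w _; exact: dot_ge0.
apply: weighted_bound_opt => // q q0.
rewrite sqr_sqrtr //.
have sS : sqvec P (fun w => \sum_(1 <= s < k.+1) trajectory s w).
  by apply: sqvec_sum => s; exact: trajectory_sqvec.
have i1 := integrable_dot (trajectory_sqvec 1) (trajectory_sqvec 1).
have ik := integrable_dot (trajectory_sqvec k.+1) (trajectory_sqvec k.+1).
have im : P.-integrable setT (fun w => (q^-1 * dot (mart k w) (mart k w))%:E).
  have := integrableZl measurableT q^-1 (integrable_dot (mart_sqvec k) (mart_sqvec k)).
  by apply: eq_integrable => // w _; rewrite -EFinM.
have i1k : P.-integrable setT (fun w => (dot (trajectory 1 w) (trajectory 1 w) +
    dot (trajectory k.+1 w) (trajectory k.+1 w))%:E).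
  by have := integrableD measurableT i1 ik; apply: eq_integrable.
have i3 : P.-integrable setT (fun w => (dot (trajectory 1 w) (trajectory 1 w) +
    dot (trajectory k.+1 w) (trajectory k.+1 w) + q^-1 * dot (mart k w) (mart k w))%:E).
  by have := integrableD measurableT i1k im; apply: eq_integrable.
apply: (@le_trans _ _ (\int[P]_w ((2 + q) * (dot (trajectory 1 w) (trajectory 1 w) +
    dot (trajectory k.+1 w) (trajectory k.+1 w) + q^-1 * dot (mart k w) (mart k w))))).
  rewrite /mean_sq -Rintegral_dotZ //; apply: le_Rintegral => //.
  - have := integrableZl measurableT c (integrable_dot sS sS).
    by apply: eq_integrable => // w _; rewrite -EFinM.
  - have := integrableZl measurableT (2 + q) i3.
    by apply: eq_integrable => // w _; rewrite -EFinM.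
  - move=> w _; apply: le_trans (coer _) _.
    by rewrite trajectory_telescope; exact: dot_sum3_le.
rewrite RintegralZl // RintegralD // RintegralD // Rintegral_dotZ //.
rewrite -mulrA ler_wpM2l //; first lra.
have qV0 : 0 <= q^-1 by rewrite invr_ge0 ltW.
have := ler_wpM2l qV0 (mart_le k v0).
have := trajectory_le 1; have := trajectory_le k.+1; rewrite /mean_sq; lra.
Qed.

End epoch.

(** * The SEG step as a matrix, and the restarted run *)

Section seg_matrix.
Context {R : realType} {n m : nat}.
Implicit Types (B : 'M[R]_(n, m)) (eta : R).

Definition skewblock B : 'M[R]_(n + m) := block_mx 0 B (- B^T) 0.
Definition diag2 (A : 'M[R]_n) (C : 'M[R]_m) : 'M[R]_(n + m) := block_mx A 0 0 C.
Definition segF eta B : 'M[R]_(n + m) :=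
  eta *: skewblock B + eta ^+ 2 *: diag2 (B *m B^T) (B^T *m B).

Definition stack (z : 'cV[R]_n * 'cV[R]_m) : 'cV[R]_(n + m) := col_mx z.1 z.2.

Lemma tr_skewblock B : (skewblock B)^T = - skewblock B.
Proof. by rewrite /skewblock tr_block_mx !trmx0 linearN /= trmxK opp_block_mx opprK !oppr0. Qed.

Lemma skewblock_sqr B : skewblock B *m skewblock B = - diag2 (B *m B^T) (B^T *m B).
Proof.
rewrite /skewblock /diag2 mulmx_block opp_block_mx !mul0mx !mulmx0 !addr0 !add0r.
by rewrite mulmxN mulNmx !oppr0.
Qed.

Lemma diag2_mul A C A' C' : diag2 A C *m diag2 A' C' = diag2 (A *m A') (C *m C').
Proof. by rewrite /diag2 mulmx_block !mul0mx !mulmx0 !addr0 !add0r. Qed.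

Lemma tr_diag2 A C : (diag2 A C)^T = diag2 A^T C^T.
Proof. by rewrite /diag2 tr_block_mx !trmx0. Qed.

Lemma dot_diag2 A C x y :
  dot (col_mx x y) (diag2 A C *m col_mx x y) = dot x (A *m x) + dot y (C *m y).
Proof. by rewrite /diag2 mul_block_col !mul0mx addr0 add0r dot_col_mx. Qed.

Lemma stack_seg_step eta B z :
  stack (seg_step eta (B, 0, 0) z) = (1%:M - segF eta B) *m stack z.
Proof.
case: z => x y; rewrite /stack /seg_step /= !addr0 mulmxBl mul1mx /segF mulmxDl.
rewrite -!scalemxAl /skewblock /diag2 !mul_block_col !mul0mx addr0 !add0r addr0.
rewrite !scale_col_mx add_col_mx opp_col_mx add_col_mx; congr col_mx.
  rewrite mulmxDr -scalemxAr mulmxA.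
  move: (B *m y) (B *m B^T *m x) => u w.
  by apply/colP => i; rewrite !mxE; ring.
rewrite mulmxBr -scalemxAr mulmxA mulNmx.
move: (B^T *m x) (B^T *m B *m y) => u w.
by apply/colP => i; rewrite !mxE; ring.
Qed.

(** The block diagonal part commutes with the skew part and is minus its square:
    the terms of odd order in [eta] cancel. *)
Lemma seg_gram eta B :
  (1%:M - segF eta B)^T *m (1%:M - segF eta B) =
  1%:M - eta ^+ 2 *: diag2 (B *m B^T) (B^T *m B)
    + eta ^+ 4 *: diag2 (B *m B^T *m (B *m B^T)) (B^T *m B *m (B^T *m B)).
Proof.
set D := diag2 (B *m B^T) _; set J := skewblock B.
have JJ : J *m J = - D by exact: skewblock_sqr.
have -> : diag2 (B *m B^T *m (B *m B^T)) (B^T *m B *m (B^T *m B)) = D *m D by rewrite diag2_mul.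
have JD : J *m D = D *m J by rewrite -[D]opprK -JJ mulNmx mulmxN mulmxA.
have TD : D^T = D by rewrite tr_diag2 !trmx_mul !trmxK.
have -> : (1%:M - segF eta B)^T = 1%:M + eta *: J - eta ^+ 2 *: D.
  have TJ : J^T = - J by exact: tr_skewblock.
  rewrite /segF -/J -/D linearB linearD !linearZ /= trmx1 TJ TD.
  by apply/matrixP => i j; rewrite !mxE; ring.
rewrite /segF -/J -/D opprD addrA.
rewrite !(mulmxDl, mulmxDr, mulmxN, mulNmx) !mul1mx !mulmx1 -!scalemxAl -!scalemxAr JJ JD.
rewrite !scalerN.
set DJ := D *m J; set DD := D *m D.
by apply/matrixP => i j; rewrite !mxE; ring.
Qed.

Lemma psd_diag2 (A : 'M[R]_n) (C : 'M[R]_m) : psd A -> psd C -> psd (diag2 A C).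
Proof.
move=> /psd_dot[sA pA] /psd_dot[sC pC]; apply/psd_dot; split=> [|v].
  by rewrite tr_diag2 sA sC.
by rewrite -[v]vsubmxK dot_diag2 addr_ge0.
Qed.

(** For [V1 = V2 = 0] the skew part J and the block diagonal part D give
    orthogonal images, so only the cross term of J with the perturbation can be
    negative. *)
Lemma seg_coercive eta B (V1 : 'M[R]_n) (V2 : 'M[R]_m) (s2 alpha lam : R) z :
  psd V1 -> psd V2 ->
  (forall x, dot x (V1 *m x) <= s2 * dot x x) ->
  (forall y, dot y (V2 *m y) <= s2 * dot y y) ->
  (forall x, lam * dot x x <= dot x (B *m B^T *m x)) ->
  (forall y, lam * dot y y <= dot y (B^T *m B *m y)) ->
  0 <= eta -> 0 <= s2 -> 0 <= alpha <= 1 -> 4 * eta ^+ 2 * s2 ^+ 2 <= alpha ^+ 2 * lam ->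
  let H := eta *: skewblock B + eta ^+ 2 *: diag2 (B *m B^T + V1) (B^T *m B + V2) in
  (1 - alpha) * eta ^+ 2 * lam * dot z z <= dot (H *m z) (H *m z).
Proof.
move=> pV1 pV2 bV1 bV2 l1 l2 e0 s0 /andP[a0 a1] hs /=.
set J := skewblock B; set D := diag2 (B *m B^T) (B^T *m B); set V := diag2 V1 V2.
have -> : diag2 (B *m B^T + V1) (B^T *m B + V2) = D + V.
  by rewrite /D /V /diag2 add_block_mx !addr0.
have pV : psd V by exact: psd_diag2.
have [sV qV] := (psd_dot V).1 pV.
have bV u : dot u (V *m u) <= s2 * dot u u.
  by rewrite -[u]vsubmxK dot_diag2 dot_col_mx mulrDr lerD.
have JJ : J *m J = - D by exact: skewblock_sqr.
have sJ u v : dot (J *m u) v = - dot u (J *m v).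
  by rewrite dotC dot_adj tr_skewblock mulNmx dotNl dotC.
have az : dot (J *m z) (J *m z) = dot z (D *m z).
  by rewrite sJ mulmxA JJ mulNmx dotNr opprK.
have la : lam * dot z z <= dot (J *m z) (J *m z).
  by rewrite az -[z]vsubmxK dot_diag2 dot_col_mx mulrDr lerD.
have JDz : dot (J *m z) (D *m z) = 0.
  rewrite -[D]opprK -JJ mulNmx dotNr -mulmxA.
  have := sJ (J *m z) (J *m z); rewrite (dotC (J *m (J *m z))); lra.
have Vz : dot (J *m z) (V *m z) ^+ 2 <= s2 ^+ 2 * (dot (J *m z) (J *m z) * dot z z).
  apply: le_trans (psd_cauchy_schwarz _ _ pV) _.
  have -> : s2 ^+ 2 * (dot (J *m z) (J *m z) * dot z z) =
    (s2 * dot (J *m z) (J *m z)) * (s2 * dot z z) by ring.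
  by apply: ler_pM => //; exact: qV.
rewrite mulmxDl -!scalemxAl [in X in _ <= X]mulmxDl scalerDr.
set a := dot (J *m z) (J *m z) in la Vz.
set t := dot (J *m z) (V *m z) in Vz.
have ap : 0 <= a by exact: dot_ge0.
have zp : 0 <= dot z z by exact: dot_ge0.
(* the cross term 2 eta t is absorbed by the fraction alpha of |Jz|^2 *)
have habs : - (alpha * a) <= 2 * eta * t.
  rewrite lerNl -[leLHS]mulN1r.
  apply: le_trans (ler_norm _) _.
  rewrite -(@ler_pXn2r _ 2) ?nnegrE ?mulr_ge0 // real_normK ?num_real //.
  have -> : (-1 * (2 * eta * t)) ^+ 2 = 4 * eta ^+ 2 * t ^+ 2 by ring.
  apply: (@le_trans _ _ (4 * eta ^+ 2 * (s2 ^+ 2 * (a * dot z z)))).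
    by rewrite ler_wpM2l // mulr_ge0 // sqr_ge0.
  apply: (@le_trans _ _ (alpha ^+ 2 * lam * (a * dot z z))).
    by rewrite mulrA ler_wpM2r // mulr_ge0.
  have -> : alpha ^+ 2 * lam * (a * dot z z) = alpha ^+ 2 * a * (lam * dot z z) by ring.
  have -> : (alpha * a) ^+ 2 = alpha ^+ 2 * a * a by ring.
  by rewrite ler_wpM2l // mulr_ge0 // sqr_ge0.
have key : (1 - alpha) * eta ^+ 2 * lam * dot z z <= eta ^+ 2 * a + eta ^+ 2 * (2 * eta * t).
  rewrite -mulrDr; have -> : (1 - alpha) * eta ^+ 2 * lam * dot z z =
    eta ^+ 2 * ((1 - alpha) * (lam * dot z z)) by ring.
  apply: ler_wpM2l; first exact: sqr_ge0.
  apply: (@le_trans _ _ ((1 - alpha) * a)); last lra.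
  by rewrite ler_wpM2l // subr_ge0.
apply: le_trans key _.
move WE : (eta ^+ 2 *: (D *m z) + eta ^+ 2 *: (V *m z)) => W.
have := dot_ge0 W.
have -> : dot (eta *: (J *m z) + W) (eta *: (J *m z) + W) =
    eta ^+ 2 * a + 2 * eta * dot (J *m z) W + dot W W.
  by rewrite !dotDr !dotDl !dotZr !dotZl (dotC W) /a; ring.
have -> : dot (J *m z) W = eta ^+ 2 * t.
  by rewrite -WE dotDr !dotZr JDz mulr0 add0r.
by move=> W0; rewrite -subr_ge0; have -> : eta ^+ 2 * a + 2 * eta * (eta ^+ 2 * t) + dot W W -
  (eta ^+ 2 * a + eta ^+ 2 * (2 * eta * t)) = dot W W by ring.
Qed.

End seg_matrix.

Section restarted_run.
Context {R : realType} {n m : nat}.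
Variables (eta : R) (s : nat -> triple R n m).
Notation iterate := ('cV[R]_n * 'cV[R]_m)%type.

Fixpoint seg_iter (tau : nat) (z : iterate) (r : nat) : iterate :=
  if r is r'.+1 then seg_step eta (s (tau + r)%N) (seg_iter tau z r') else z.

(** The [q]-th restarting point when all epochs have length [k]. *)
Fixpoint epoch_avg (k : nat) (z0 : iterate) (q : nat) : iterate :=
  if q is q'.+1 then
    (k%:R)^-1 *: \sum_(1 <= r < k.+1) seg_iter (q' * k) (epoch_avg k z0 q') r
  else z0.

Let T k (i : nat) := (i * k)%N.

Lemma in_restarts k t : (1 <= t)%N -> (t \in restarts (T k)) = (k %| t)%N.
Proof.
move=> t1; apply/idP/idP; rewrite in_setE.
  by move=> [i /= _ <-]; rewrite /T dvdn_mull.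
move=> /dvdnP[i ti]; exists i => //=; rewrite lt0n; apply: contraTneq t1 => i0.
by rewrite ti i0.
Qed.

Let epoch_state k z0 q r (st : rseg_state R n m) :=
  [/\ rs_cur st = seg_iter (q * k) (epoch_avg k z0 q) r,
      rs_start st = (q * k)%N,
      rs_sum st = \sum_(1 <= i < r.+1) seg_iter (q * k) (epoch_avg k z0 q) i
    & r = 0%N -> rs_avg st = epoch_avg k z0 q].

Let rseg_step k z0 q r : (r.+1 < k)%N ->
  epoch_state k z0 q r (rseg (T k) eta s z0 (q * k + r)) ->
  epoch_state k z0 q r.+1 (rseg (T k) eta s z0 (q * k + r.+1)).
Proof.
move=> rk [h1 h2 h3 _].
have inside : (k %| q * k + r.+1)%N = false by rewrite dvdn_addr ?dvdn_mull // gtnNdvd.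
rewrite /epoch_state addnS /= in_restarts // -addnS inside h1 h2 h3; split=> //.
by rewrite [in RHS]big_nat_recr.
Qed.

Lemma rseg_epoch k z0 q r : (r < k)%N ->
  epoch_state k z0 q r (rseg (T k) eta s z0 (q * k + r)).
Proof.
move=> rk /=; have k0 : (0 < k)%N by exact: leq_ltn_trans rk.
elim: q r rk => [|q IHq]; elim=> [|r IHr] rk.
- by split=> //=; rewrite big_geq.
- by apply: rseg_step => //; apply: IHr; exact: ltnW.
- have [|h1 h2 h3 _] := IHq k.-1; first by rewrite prednK.
  have -> : (q.+1 * k + 0 = (q * k + k.-1).+1)%N by rewrite addn0 mulSn addnC -addnS prednK.
  rewrite /epoch_state /= in_restarts // -addnS prednK // dvdn_addr ?dvdn_mull // dvdnn /= h2.
  have E : \sum_(1 <= r < k.+1) seg_iter (q * k) (epoch_avg k z0 q) r =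
    \sum_(1 <= i < k.-1.+1) seg_iter (q * k) (epoch_avg k z0 q) i +
    seg_step eta (s (q * k + k)) (seg_iter (q * k) (epoch_avg k z0 q) k.-1).
    by case: k k0 {rk h1 h2 h3 IHq} => // k' _; rewrite big_nat_recr.
  have -> : (q * k + k - q * k = k)%N by rewrite addKn.
  rewrite h1 h3 -E; split=> //; first by rewrite mulSn addnC.
  by rewrite [RHS]big_geq.
- by apply: rseg_step => //; apply: IHr; exact: ltnW.
Qed.

Lemma rseg_outputE k z0 q : (0 < k)%N ->
  rseg_output (T k) eta s z0 (q * k) = epoch_avg k z0 q.
Proof.
move=> k0; have [_ _ _] := rseg_epoch z0 q k0; rewrite addn0; exact.
Qed.

End restarted_run.

(** * Expectations of random matrices *)

Section matrix_expectation.
Context d (Omega : measurableType d) (R : realType) (P : probability Omega R).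

Lemma EmxE n m (Y : Omega -> 'M[R]_(n, m)) i j : Emx P Y i j = \int[P]_w Y w i j.
Proof. by rewrite mxE fine_expect. Qed.

Lemma mx_integrableD n m (Y Z : Omega -> 'M[R]_(n, m)) :
  mx_integrable P Y -> mx_integrable P Z -> mx_integrable P (fun w => Y w + Z w).
Proof.
move=> iY iZ i j; have := integrableD measurableT (iY i j) (iZ i j).
by apply: eq_integrable => // w _; rewrite mxE EFinD.
Qed.

Lemma EmxD n m (Y Z : Omega -> 'M[R]_(n, m)) : mx_integrable P Y -> mx_integrable P Z ->
  Emx P (fun w => Y w + Z w) = Emx P Y + Emx P Z.
Proof.
move=> iY iZ; apply/matrixP => i j; rewrite [RHS]mxE !EmxE.
rewrite -RintegralD //; [|exact: iY|exact: iZ].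
by apply: eq_Rintegral => w _; rewrite mxE.
Qed.

Lemma mx_integrableZ n m c (Y : Omega -> 'M[R]_(n, m)) :
  mx_integrable P Y -> mx_integrable P (fun w => c *: Y w).
Proof.
move=> iY i j; have := integrableZl measurableT c (iY i j).
by apply: eq_integrable => // w _; rewrite mxE EFinM.
Qed.

Lemma EmxZ n m c (Y : Omega -> 'M[R]_(n, m)) : mx_integrable P Y ->
  Emx P (fun w => c *: Y w) = c *: Emx P Y.
Proof.
move=> iY; apply/matrixP => i j; rewrite [RHS]mxE !EmxE.
rewrite -RintegralZl //; last exact: iY.
by apply: eq_Rintegral => w _; rewrite mxE.
Qed.

Lemma mx_integrable_cst n m (C : 'M[R]_(n, m)) : mx_integrable P (fun=> C).
Proof. by move=> i j; exact: (finite_measure_integrable_cst P). Qed.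

Lemma Emx_cst n m (C : 'M[R]_(n, m)) : Emx P (fun=> C) = C.
Proof. by apply/matrixP => i j; rewrite EmxE Rintegral_prob_cst. Qed.

Lemma mx_integrableB n m (Y Z : Omega -> 'M[R]_(n, m)) :
  mx_integrable P Y -> mx_integrable P Z -> mx_integrable P (fun w => Y w - Z w).
Proof.
move=> iY iZ; under eq_fun do rewrite -scaleN1r.
by apply: mx_integrableD => //; exact: mx_integrableZ.
Qed.

Lemma EmxB n m (Y Z : Omega -> 'M[R]_(n, m)) : mx_integrable P Y -> mx_integrable P Z ->
  Emx P (fun w => Y w - Z w) = Emx P Y - Emx P Z.
Proof.
move=> iY iZ; under eq_fun do rewrite -scaleN1r.
by rewrite EmxD ?EmxZ ?scaleN1r //; exact: mx_integrableZ.
Qed.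

Lemma mx_integrable_tr n m (Y : Omega -> 'M[R]_(n, m)) :
  mx_integrable P Y -> mx_integrable P (fun w => (Y w)^T).
Proof. by move=> iY i j; under eq_fun do rewrite mxE; exact: iY. Qed.

Lemma Emx_tr n m (Y : Omega -> 'M[R]_(n, m)) : Emx P (fun w => (Y w)^T) = (Emx P Y)^T.
Proof.
by apply/matrixP => i j; rewrite [RHS]mxE !EmxE; apply: eq_Rintegral => w _; rewrite mxE.
Qed.

Lemma mx_integrable_mull n m p (C : 'M[R]_(p, n)) (Y : Omega -> 'M[R]_(n, m)) :
  mx_integrable P Y -> mx_integrable P (fun w => C *m Y w).
Proof.
move=> iY i j; under eq_fun do rewrite mxE; apply: integrable_sumr => k.
have := integrableZl measurableT (C i k) (iY k j).
by apply: eq_integrable => // w _; rewrite EFinM.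
Qed.

Lemma Emx_mull n m p (C : 'M[R]_(p, n)) (Y : Omega -> 'M[R]_(n, m)) :
  mx_integrable P Y -> Emx P (fun w => C *m Y w) = C *m Emx P Y.
Proof.
move=> iY; apply/matrixP => i j; rewrite EmxE [RHS]mxE.
under eq_Rintegral do rewrite mxE.
rewrite Rintegral_sumr.
  by apply: eq_bigr => k _; rewrite EmxE RintegralZl //; exact: iY.
move=> k; have := integrableZl measurableT (C i k) (iY k j).
by apply: eq_integrable => // w _; rewrite EFinM.
Qed.

Lemma mx_integrable_mulr n m p (Y : Omega -> 'M[R]_(n, m)) (C : 'M[R]_(m, p)) :
  mx_integrable P Y -> mx_integrable P (fun w => Y w *m C).
Proof.
move=> iY; under eq_fun do rewrite -[_ *m C]trmxK trmx_mul.
by apply: mx_integrable_tr; apply: mx_integrable_mull; exact: mx_integrable_tr.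
Qed.

Lemma Emx_mulr n m p (Y : Omega -> 'M[R]_(n, m)) (C : 'M[R]_(m, p)) :
  mx_integrable P Y -> Emx P (fun w => Y w *m C) = Emx P Y *m C.
Proof.
move=> iY; under eq_fun do rewrite -[_ *m C]trmxK trmx_mul.
by rewrite Emx_tr Emx_mull ?Emx_tr ?trmx_mul ?trmxK //; exact: mx_integrable_tr.
Qed.

Lemma mx_integrable_diag2 n m (Y : Omega -> 'M[R]_n) (Z : Omega -> 'M[R]_m) :
  mx_integrable P Y -> mx_integrable P Z -> mx_integrable P (fun w => diag2 (Y w) (Z w)).
Proof.
move=> iY iZ i j.
case: (split_ordP i) => a ->; case: (split_ordP j) => b ->.
- by under eq_fun do rewrite block_mxEul; exact: iY.
- by under eq_fun do rewrite block_mxEur mxE; exact: (finite_measure_integrable_cst P).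
- by under eq_fun do rewrite block_mxEdl mxE; exact: (finite_measure_integrable_cst P).
- by under eq_fun do rewrite block_mxEdr; exact: iZ.
Qed.

Lemma Emx_diag2 n m (Y : Omega -> 'M[R]_n) (Z : Omega -> 'M[R]_m) :
  Emx P (fun w => diag2 (Y w) (Z w)) = diag2 (Emx P Y) (Emx P Z).
Proof.
apply/matrixP => i j; rewrite EmxE.
case: (split_ordP i) => a ->; case: (split_ordP j) => b ->.
- by under eq_Rintegral do rewrite block_mxEul; rewrite block_mxEul EmxE.
- by under eq_Rintegral do rewrite block_mxEur mxE; rewrite block_mxEur mxE Rintegral_prob_cst.
- by under eq_Rintegral do rewrite block_mxEdl mxE; rewrite block_mxEdl mxE Rintegral_prob_cst.
- by under eq_Rintegral do rewrite block_mxEdr; rewrite block_mxEdr EmxE.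
Qed.

Lemma sqint_skewblock n m (Y : Omega -> 'M[R]_(n, m)) :
  (forall i j, sqint P (fun w => Y w i j)) -> forall i j, sqint P (fun w => skewblock (Y w) i j).
Proof.
move=> sY i j.
case: (split_ordP i) => a ->; case: (split_ordP j) => b ->.
- by under eq_fun do rewrite block_mxEul mxE; exact: sqint_cst.
- by under eq_fun do rewrite block_mxEur; exact: sY.
- by under eq_fun do rewrite block_mxEdl !mxE -mulN1r; apply: sqintZ; exact: sY.
- by under eq_fun do rewrite block_mxEdr mxE; exact: sqint_cst.
Qed.

Lemma sqint_diag2 n m (Y : Omega -> 'M[R]_n) (Z : Omega -> 'M[R]_m) :
  (forall i j, sqint P (fun w => Y w i j)) -> (forall i j, sqint P (fun w => Z w i j)) ->
  forall i j, sqint P (fun w => diag2 (Y w) (Z w) i j).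
Proof.
move=> sY sZ i j.
case: (split_ordP i) => a ->; case: (split_ordP j) => b ->.
- by under eq_fun do rewrite block_mxEul; exact: sY.
- by under eq_fun do rewrite block_mxEur mxE; exact: sqint_cst.
- by under eq_fun do rewrite block_mxEdl mxE; exact: sqint_cst.
- by under eq_fun do rewrite block_mxEdr; exact: sZ.
Qed.

Lemma Emx_skewblock n m (Y : Omega -> 'M[R]_(n, m)) : mx_integrable P Y ->
  Emx P (fun w => skewblock (Y w)) = skewblock (Emx P Y).
Proof.
move=> iY; apply/matrixP => i j; rewrite EmxE.
case: (split_ordP i) => a ->; case: (split_ordP j) => b ->.
- by under eq_Rintegral do rewrite block_mxEul mxE; rewrite block_mxEul mxE Rintegral_prob_cst.
- by under eq_Rintegral do rewrite block_mxEur; rewrite block_mxEur EmxE.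
- under eq_Rintegral do rewrite block_mxEdl !mxE -mulN1r.
  by rewrite block_mxEdl !mxE fine_expect RintegralZl ?mulN1r //; exact: iY.
- by under eq_Rintegral do rewrite block_mxEdr mxE; rewrite block_mxEdr mxE Rintegral_prob_cst.
Qed.

Lemma sqint_mx_integrable n m (Y : Omega -> 'M[R]_(n, m)) :
  (forall i j, sqint P (fun w => Y w i j)) -> mx_integrable P Y.
Proof. by move=> sY i j; exact: sqint_integrable. Qed.

Lemma mx_integrable_mul n m p (Y : Omega -> 'M[R]_(n, m)) (Z : Omega -> 'M[R]_(m, p)) :
  (forall i j, sqint P (fun w => Y w i j)) -> (forall i j, sqint P (fun w => Z w i j)) ->
  mx_integrable P (fun w => Y w *m Z w).
Proof.
move=> sY sZ i j; under eq_fun do rewrite mxE.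
by apply: integrable_sumr => k; exact: sqint_mul.
Qed.

(** A diagonal entry of the Gram matrix is the sum of the squares of a row. *)
Lemma sqint_of_gram n m (Y : Omega -> 'M[R]_(n, m)) :
  (forall i j, measurable_fun setT (fun w => Y w i j)) ->
  mx_integrable P (fun w => Y w *m (Y w)^T) ->
  forall i j, sqint P (fun w => Y w i j).
Proof.
move=> mY iG i j; split => //.
apply: (le_integrable measurableT _ _ (iG i i)).
  by apply/measurable_EFinP; exact: measurable_funX.
move=> w _; rewrite /= lee_fin ger0_norm ?sqr_ge0 // mxE.
apply: le_trans (ler_norm _); rewrite (bigD1 j) //= mxE -expr2 lerDl.
by apply: sumr_ge0 => k _; rewrite mxE -expr2 sqr_ge0.
Qed.

Lemma dot_EmxE n (Y : Omega -> 'M[R]_n) u v : mx_integrable P Y ->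
  dot u (Emx P Y *m v) = \int[P]_w dot u (Y w *m v).
Proof.
move=> iY; rewrite -Emx_mulr // /dot -Emx_mull; last exact: mx_integrable_mulr.
by rewrite EmxE.
Qed.

Lemma dot_Emx_integrable n (Y : Omega -> 'M[R]_n) u v : mx_integrable P Y ->
  P.-integrable setT (fun w => (dot u (Y w *m v))%:E).
Proof.
by move=> iY; apply: (mx_integrable_mull u^T (mx_integrable_mulr v iY)).
Qed.

Lemma dot_Emx_le n (Y Z : Omega -> 'M[R]_n) z : mx_integrable P Y -> mx_integrable P Z ->
  (forall w, dot z (Y w *m z) <= dot z (Z w *m z)) ->
  dot z (Emx P Y *m z) <= dot z (Emx P Z *m z).
Proof.
move=> iY iZ h; rewrite !dot_EmxE //.
by apply: le_Rintegral => //; exact: dot_Emx_integrable.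
Qed.

End matrix_expectation.

(** * Moments of the SEG matrix *)

Section measurable_matrices.
Context d (T : measurableType d) (R : realType).

Definition mx_measurable n m (G : T -> 'M[R]_(n, m)) : Prop :=
  forall i j, measurable_fun setT (fun x => G x i j).

Lemma mx_measurable_cst n m (C : 'M[R]_(n, m)) : mx_measurable (fun=> C).
Proof. by move=> i j; exact: measurable_cst. Qed.

Lemma mx_measurableD n m (G H : T -> 'M[R]_(n, m)) :
  mx_measurable G -> mx_measurable H -> mx_measurable (fun x => G x + H x).
Proof. by move=> mG mH i j; under eq_fun do rewrite mxE; exact: measurable_funD. Qed.

Lemma mx_measurableZ n m c (G : T -> 'M[R]_(n, m)) :
  mx_measurable G -> mx_measurable (fun x => c *: G x).
Proof.
move=> mG i j; under eq_fun do rewrite mxE.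
by apply: measurable_funM => //; exact: measurable_cst.
Qed.

Lemma mx_measurableB n m (G H : T -> 'M[R]_(n, m)) :
  mx_measurable G -> mx_measurable H -> mx_measurable (fun x => G x - H x).
Proof.
move=> mG mH; under eq_fun do rewrite -scaleN1r.
by apply: mx_measurableD => //; exact: mx_measurableZ.
Qed.

Lemma mx_measurableM n m p (G : T -> 'M[R]_(n, m)) (H : T -> 'M[R]_(m, p)) :
  mx_measurable G -> mx_measurable H -> mx_measurable (fun x => G x *m H x).
Proof.
move=> mG mH i j; under eq_fun do rewrite mxE.
by apply: measurable_sum => k; exact: measurable_funM.
Qed.

Lemma mx_measurable_tr n m (G : T -> 'M[R]_(n, m)) :
  mx_measurable G -> mx_measurable (fun x => (G x)^T).
Proof. by move=> mG i j; under eq_fun do rewrite mxE; exact: mG. Qed.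

Lemma mx_measurable_sum I (r : seq I) n m (G : I -> T -> 'M[R]_(n, m)) :
  (forall i, mx_measurable (G i)) -> mx_measurable (fun x => \sum_(i <- r) G i x).
Proof.
move=> mG i j; under eq_fun do rewrite summxE.
by apply: measurable_sum => k; exact: mG.
Qed.

Lemma mx_measurable_skewblock n m (G : T -> 'M[R]_(n, m)) :
  mx_measurable G -> mx_measurable (fun x => skewblock (G x)).
Proof.
move=> mG i j; case: (split_ordP i) => a ->; case: (split_ordP j) => b ->.
- by under eq_fun do rewrite block_mxEul; exact: mx_measurable_cst.
- by under eq_fun do rewrite block_mxEur; exact: mG.
- under eq_fun do rewrite block_mxEdl -scaleN1r.
  by apply: mx_measurableZ; exact: mx_measurable_tr.
- by under eq_fun do rewrite block_mxEdr; exact: mx_measurable_cst.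
Qed.

Lemma mx_measurable_diag2 n m (G : T -> 'M[R]_n) (H : T -> 'M[R]_m) :
  mx_measurable G -> mx_measurable H -> mx_measurable (fun x => diag2 (G x) (H x)).
Proof.
move=> mG mH i j; case: (split_ordP i) => a ->; case: (split_ordP j) => b ->.
- by under eq_fun do rewrite block_mxEul; exact: mG.
- by under eq_fun do rewrite block_mxEur; exact: mx_measurable_cst.
- by under eq_fun do rewrite block_mxEdl; exact: mx_measurable_cst.
- by under eq_fun do rewrite block_mxEdr; exact: mH.
Qed.

Lemma mx_measurable_segF n m eta (G : T -> 'M[R]_(n, m)) :
  mx_measurable G -> mx_measurable (fun x => segF eta (G x)).
Proof.
move=> mG; apply: mx_measurableD; apply: mx_measurableZ.
  exact: mx_measurable_skewblock.
by apply: mx_measurable_diag2; apply: mx_measurableM => //; exact: mx_measurable_tr.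
Qed.

Lemma measurable_mx_measurable n m (G : T -> 'M[R]_(n, m)) :
  measurable_fun setT G -> mx_measurable G.
Proof.
move=> mG i j; apply: (measurableT_comp (f := fun A : 'M[R]_(n, m) => A i j) _ mG).
move=> _ Y mY; apply: sub_sigma_algebra; exists (i, j) => //; exists Y => //.
Qed.

Lemma measurable_triple n m (X : T -> triple R n m) : measurable_fun setT X ->
  [/\ mx_measurable (fun x => (X x).1.1), mx_measurable (fun x => (X x).1.2)
    & mx_measurable (fun x => (X x).2)].
Proof.
move=> mX; split; apply: measurable_mx_measurable.
- exact: (measurableT_comp measurable_fst (measurableT_comp measurable_fst mX)).
- exact: (measurableT_comp measurable_snd (measurableT_comp measurable_fst mX)).
- exact: (measurableT_comp measurable_snd mX).
Qed.

End measurable_matrices.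

Lemma weighted_variances_le {R : realDomainType} (e s t a b p1 p2 q1 q2 : R) :
  p1 <= s * a -> p2 <= s * b -> q1 <= t * a -> q2 <= t * b ->
  2 * e ^+ 2 * (p1 + p2) + 2 * e ^+ 4 * (q1 + q2)
    <= 2 * e ^+ 2 * (s + e ^+ 2 * t) * (a + b).
Proof.
move=> h1 h2 h3 h4.
have e2 : 0 <= 2 * e ^+ 2 by rewrite mulr_ge0 // sqr_ge0.
have e4 : 0 <= 2 * e ^+ 4 by rewrite mulr_ge0 // exprn_even_ge0.
have := lerD (ler_wpM2l e2 (lerD h1 h2)) (ler_wpM2l e4 (lerD h3 h4)).
lra.
Qed.

Section seg_noise.
Context d0 (Omega0 : measurableType d0) (R : realType) (P0 : probability Omega0 R).
Context n (xi : {RV P0 >-> triple R n n}) (sigmaB sigmaB2 : R).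
Hypothesis hA1 : noiseB P0 xi sigmaB sigmaB2.

Notation B := (Bmean P0 xi).
Notation M := (Mmean P0 xi).
Notation Mh := (Mhatmean P0 xi).
Notation Bxi := (Bxi xi).
Notation Mxi := (Mxi xi).
Notation Mhatxi := (Mhatxi xi).

Let iB : mx_integrable P0 Bxi. Proof. by case: hA1 => -[]. Qed.
Let iM : mx_integrable P0 Mxi. Proof. by case: hA1 => -[]. Qed.
Let iMh : mx_integrable P0 Mhatxi. Proof. by case: hA1 => -[]. Qed.
Let iM2 : mx_integrable P0 (fun w => Mxi w *m Mxi w). Proof. by case: hA1 => -[]. Qed.
Let iMh2 : mx_integrable P0 (fun w => Mhatxi w *m Mhatxi w). Proof. by case: hA1 => -[]. Qed.

Let trM w : (Mxi w)^T = Mxi w.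
Proof. by rewrite /Defs.Mxi trmx_mul trmxK. Qed.
Let trMh w : (Mhatxi w)^T = Mhatxi w.
Proof. by rewrite /Defs.Mhatxi trmx_mul trmxK. Qed.

Lemma Mmean_sym : M^T = M.
Proof. by rewrite /Mmean -Emx_tr; under eq_fun do rewrite trM. Qed.
Lemma Mhatmean_sym : Mh^T = Mh.
Proof. by rewrite /Mhatmean -Emx_tr; under eq_fun do rewrite trMh. Qed.
Lemma M2mean_sym : (M2mean P0 xi)^T = M2mean P0 xi.
Proof. by rewrite /M2mean -Emx_tr; under eq_fun do rewrite trmx_mul trM. Qed.
Lemma Mhat2mean_sym : (Mhat2mean P0 xi)^T = Mhat2mean P0 xi.
Proof. by rewrite /Mhat2mean -Emx_tr; under eq_fun do rewrite trmx_mul trMh. Qed.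

Let mB : mx_measurable Bxi.
Proof. by case: (measurable_triple (measurable_funPT xi)). Qed.
Let mM : mx_measurable Mxi.
Proof. by apply: mx_measurableM => //; exact: mx_measurable_tr. Qed.
Let mMh : mx_measurable Mhatxi.
Proof. by apply: mx_measurableM => //; exact: mx_measurable_tr. Qed.

Let sB i j : sqint P0 (fun w => Bxi w i j).
Proof. exact: sqint_of_gram. Qed.
Let sM i j : sqint P0 (fun w => Mxi w i j).
Proof. by apply: sqint_of_gram => //; under eq_fun do rewrite trM. Qed.
Let sMh i j : sqint P0 (fun w => Mhatxi w i j).
Proof. by apply: sqint_of_gram => //; under eq_fun do rewrite trMh. Qed.

Variable eta : R.

Lemma segF_sqint i j : sqint P0 (fun w => segF eta (Bxi w) i j).
Proof.
under eq_fun do rewrite /segF mxE [X in X + _]mxE [X in _ + X]mxE.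
apply: sqintD; apply: sqintZ; first exact: sqint_skewblock.
exact: sqint_diag2.
Qed.

Let iD : mx_integrable P0 (fun w => diag2 (Mxi w) (Mhatxi w)).
Proof. exact: mx_integrable_diag2. Qed.

Lemma Emx_segF : Emx P0 (fun w => segF eta (Bxi w)) = eta *: skewblock B + eta ^+ 2 *: diag2 M Mh.
Proof.
have iS : mx_integrable P0 (fun w => skewblock (Bxi w)).
  by apply: sqint_mx_integrable; exact: sqint_skewblock.
rewrite /segF EmxD ?EmxZ ?Emx_skewblock ?Emx_diag2 //; exact: mx_integrableZ.
Qed.

(** After [seg_gram], the two assumptions bound the fourth-order moment by the
    second-order one. *)
Lemma segF_nonexpansive z :
  (forall x, eta ^+ 2 * dot x (M2mean P0 xi *m x) <= dot x (M *m x)) ->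
  (forall x, eta ^+ 2 * dot x (Mhat2mean P0 xi *m x) <= dot x (Mh *m x)) ->
  dot z (Emx P0 (fun w => (1%:M - segF eta (Bxi w))^T *m (1%:M - segF eta (Bxi w))) *m z)
  <= dot z z.
Proof.
move=> h1 h2.
have iD2 : mx_integrable P0 (fun w => diag2 (Mxi w *m Mxi w) (Mhatxi w *m Mhatxi w)).
  exact: mx_integrable_diag2.
have -> : Emx P0 (fun w => (1%:M - segF eta (Bxi w))^T *m (1%:M - segF eta (Bxi w))) =
    1%:M - eta ^+ 2 *: diag2 M Mh + eta ^+ 4 *: diag2 (M2mean P0 xi) (Mhat2mean P0 xi).
  under eq_fun do rewrite seg_gram.
  rewrite EmxD ?EmxB ?Emx_cst ?EmxZ ?Emx_diag2 //.
  - exact: mx_integrable_cst.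
  - exact: mx_integrableZ.
  - by apply: mx_integrableB; [exact: mx_integrable_cst|exact: mx_integrableZ].
  - exact: mx_integrableZ.
rewrite mulmxDl mulmxBl mul1mx -!scalemxAl dotDr dotBr !dotZr.
rewrite -[z]vsubmxK !dot_diag2 dot_col_mx.
set x := usubmx z; set y := dsubmx z.
have := h1 x; have := h2 y => k2 k1.
have e0 : 0 <= eta ^+ 2 by exact: sqr_ge0.
have := ler_wpM2l e0 (lerD k1 k2).
rewrite -mulrDr mulrA -exprD; lra.
Qed.

(** The deviation is the sum of a skew part, linear in [B_xi - B], and a block
    diagonal part; |a + b|^2 <= 2 |a|^2 + 2 |b|^2 separates them, and the Gram
    matrix of each part is block diagonal. *)
Lemma segF_variance z :
  dot z (Emx P0 (fun w =>
    (segF eta (Bxi w) - Emx P0 (fun w => segF eta (Bxi w)))^T *m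
    (segF eta (Bxi w) - Emx P0 (fun w => segF eta (Bxi w)))) *m z)
  <= 2 * eta ^+ 2 * (sigmaB ^+ 2 + eta ^+ 2 * sigmaB2 ^+ 2) * dot z z.
Proof.
rewrite Emx_segF.
pose S w := skewblock (Bxi w - B); pose D w := diag2 (Mxi w - M) (Mhatxi w - Mh).
have E w : segF eta (Bxi w) - (eta *: skewblock B + eta ^+ 2 *: diag2 M Mh) =
    eta *: S w + eta ^+ 2 *: D w.
  have -> : S w = skewblock (Bxi w) - skewblock B.
    rewrite /S /skewblock opp_block_mx add_block_mx !oppr0 !addr0.
    by congr block_mx; rewrite linearB /= opprB opprK addrC.
  have -> : D w = diag2 (Mxi w) (Mhatxi w) - diag2 M Mh.
    by rewrite /D /diag2 opp_block_mx add_block_mx !oppr0 !addr0.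
  by rewrite /segF !scalerBr opprD addrACA.
under eq_fun do rewrite E.
have sBB i j : sqint P0 (fun w => (Bxi w - B) i j).
  by under eq_fun do rewrite mxE [X in _ + X]mxE; apply: sqintD => //; exact: sqint_cst.
have sMM i j : sqint P0 (fun w => (Mxi w - M) i j).
  by under eq_fun do rewrite mxE [X in _ + X]mxE; apply: sqintD => //; exact: sqint_cst.
have sMMh i j : sqint P0 (fun w => (Mhatxi w - Mh) i j).
  by under eq_fun do rewrite mxE [X in _ + X]mxE; apply: sqintD => //; exact: sqint_cst.
have sBBT i j : sqint P0 (fun w => (Bxi w - B)^T i j).
  by under eq_fun do rewrite mxE; exact: sBB.
have sS i j : sqint P0 (fun w => S w i j) by exact: sqint_skewblock.
have sD i j : sqint P0 (fun w => D w i j) by exact: sqint_diag2.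
have sE i j : sqint P0 (fun w => (eta *: S w + eta ^+ 2 *: D w) i j).
  under eq_fun do rewrite mxE [X in X + _]mxE [X in _ + X]mxE.
  by apply: sqintD; exact: sqintZ.
have sT (Y : Omega0 -> 'M[R]_(n + n)) : (forall i j, sqint P0 (fun w => Y w i j)) ->
    forall i j, sqint P0 (fun w => (Y w)^T i j).
  by move=> sY i j; under eq_fun do rewrite mxE; exact: sY.
pose G w := diag2 ((Bxi w - B) *m (Bxi w - B)^T) ((Bxi w - B)^T *m (Bxi w - B)).
pose Q w := diag2 ((Mxi w - M) *m (Mxi w - M)) ((Mhatxi w - Mh) *m (Mhatxi w - Mh)).
have iG : mx_integrable P0 G by apply: mx_integrable_diag2; exact: mx_integrable_mul.
have iQ : mx_integrable P0 Q by apply: mx_integrable_diag2; exact: mx_integrable_mul.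
apply: (@le_trans _ _ (dot z (Emx P0 (fun w =>
    (2 * eta ^+ 2) *: G w + (2 * eta ^+ 4) *: Q w) *m z))).
  apply: dot_Emx_le.
  - by apply: mx_integrable_mul => //; exact: sT.
  - by apply: mx_integrableD; exact: mx_integrableZ.
  move=> w; rewrite -mulmxA dot_adj trmxK.
  have SG : dot z (G w *m z) = dot (S w *m z) (S w *m z).
    by rewrite /S [RHS]dot_adj mulmxA tr_skewblock mulNmx skewblock_sqr opprK dotC.
  have DQ : dot z (Q w *m z) = dot (D w *m z) (D w *m z).
    rewrite /D [RHS]dot_adj mulmxA tr_diag2 [(Mxi w - M)^T]linearB
      [(Mhatxi w - Mh)^T]linearB /= trM trMh Mmean_sym Mhatmean_sym.
    by rewrite diag2_mul dotC.
  rewrite !(mulmxDl, dotDr, dotDl) -!scalemxAl !(dotZr, dotZl) SG DQ.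
  set a := S w *m z; set b := D w *m z.
  have := dot_ge0 (eta *: a - eta ^+ 2 *: b).
  rewrite !(dotDr, dotDl, dotNr, dotNl, dotZr, dotZl) (dotC b a).
  lra.
rewrite EmxD ?EmxZ ?Emx_diag2 //; [|exact: mx_integrableZ|exact: mx_integrableZ].
rewrite mulmxDl -2!scalemxAl dotDr 2!dotZr -[z]vsubmxK 2!dot_diag2 dot_col_mx.
set x := usubmx z; set y := dsubmx z.
case: hA1 => _ _ _ _ _ hl hr hMh hMM.
have k1 : dot x (Emx P0 (fun w => (Bxi w - B) *m (Bxi w - B)^T) *m x) <= sigmaB ^+ 2 * dot x x.
  by apply: le_trans (opnorm_ge _ _) _; exact: ler_wpM2r (dot_ge0 _) _ _ hr.
have k2 : dot y (Emx P0 (fun w => (Bxi w - B)^T *m (Bxi w - B)) *m y) <= sigmaB ^+ 2 * dot y y.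
  by apply: le_trans (opnorm_ge _ _) _; exact: ler_wpM2r (dot_ge0 _) _ _ hl.
have k3 : dot x (Emx P0 (fun w => (Mxi w - M) *m (Mxi w - M)) *m x) <= sigmaB2 ^+ 2 * dot x x.
  by apply: le_trans (opnorm_ge _ _) _; exact: ler_wpM2r (dot_ge0 _) _ _ hMM.
have k4 : dot y (Emx P0 (fun w => (Mhatxi w - Mh) *m (Mhatxi w - Mh)) *m y)
    <= sigmaB2 ^+ 2 * dot y y.
  by apply: le_trans (opnorm_ge _ _) _; exact: ler_wpM2r (dot_ge0 _) _ _ hMh.
exact: weighted_variances_le.
Qed.

Let V1 := Emx P0 (fun w => (Bxi w - B) *m (Bxi w - B)^T).
Let V2 := Emx P0 (fun w => (Bxi w - B)^T *m (Bxi w - B)).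

Let Mmean_split : M = B *m B^T + V1.
Proof.
have iBT : mx_integrable P0 (fun w => (Bxi w)^T) by exact: mx_integrable_tr.
have i1 : mx_integrable P0 (fun w => B *m (Bxi w)^T) by exact: mx_integrable_mull.
have i2 : mx_integrable P0 (fun w => Bxi w *m B^T) by exact: mx_integrable_mulr.
rewrite /V1.
have E w : (Bxi w - B) *m (Bxi w - B)^T = Mxi w - B *m (Bxi w)^T - Bxi w *m B^T + B *m B^T.
  by rewrite linearB /= mulmxBr !mulmxBl opprB addrA addrAC.
under eq_fun do rewrite E.
have i12 := mx_integrableB iM i1; have i123 := mx_integrableB i12 i2.
rewrite (EmxD i123 (mx_integrable_cst P0 _)) (EmxB i12 i2) (EmxB iM i1).
rewrite Emx_mull // Emx_mulr // Emx_tr Emx_cst subrK addrC.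
by rewrite subrK.
Qed.

Let Mhatmean_split : Mh = B^T *m B + V2.
Proof.
have iBT : mx_integrable P0 (fun w => (Bxi w)^T) by exact: mx_integrable_tr.
have i1 : mx_integrable P0 (fun w => B^T *m Bxi w) by exact: mx_integrable_mull.
have i2 : mx_integrable P0 (fun w => (Bxi w)^T *m B) by exact: mx_integrable_mulr.
rewrite /V2.
have E w : (Bxi w - B)^T *m (Bxi w - B) = Mhatxi w - B^T *m Bxi w - (Bxi w)^T *m B + B^T *m B.
  by rewrite [(_ - _)^T]linearB /= mulmxBr !mulmxBl opprB addrA addrAC.
under eq_fun do rewrite E.
have i12 := mx_integrableB iMh i1; have i123 := mx_integrableB i12 i2.
rewrite (EmxD i123 (mx_integrable_cst P0 _)) (EmxB i12 i2) (EmxB iMh i1).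
rewrite Emx_mull // Emx_mulr // Emx_tr Emx_cst subrK addrC.
by rewrite subrK.
Qed.

(** The means of the Gram matrices are those of the mean matrix plus the
    covariances [V1] and [V2], whose norms are at most [sigmaB ^+ 2]. *)
Lemma segF_coercive alpha z : B \in unitmx -> 0 <= eta -> 0 <= alpha <= 1 ->
  4 * eta ^+ 2 * (sigmaB ^+ 2) ^+ 2 <= alpha ^+ 2 * lambda_min (B *m B^T) ->
  let H := Emx P0 (fun w => segF eta (Bxi w)) in
  (1 - alpha) * eta ^+ 2 * lambda_min (B *m B^T) * dot z z <= dot (H *m z) (H *m z).
Proof.
move=> uB e0 al hs; rewrite /= Emx_segF Mmean_split Mhatmean_split.
have sBB i j : sqint P0 (fun w => (Bxi w - B) i j).
  by under eq_fun do rewrite mxE [X in _ + X]mxE; apply: sqintD => //; exact: sqint_cst.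
have sBBT i j : sqint P0 (fun w => (Bxi w - B)^T i j).
  by under eq_fun do rewrite mxE; exact: sBB.
have i1 : mx_integrable P0 (fun w => (Bxi w - B) *m (Bxi w - B)^T) by exact: mx_integrable_mul.
have i2 : mx_integrable P0 (fun w => (Bxi w - B)^T *m (Bxi w - B)) by exact: mx_integrable_mul.
case: hA1 => _ _ _ _ _ hl hr _ _.
have pV1 : psd V1.
  apply/psd_dot; split=> [|v]; first by rewrite /V1 -Emx_tr; under eq_fun do rewrite trmx_mul trmxK.
  rewrite dot_EmxE //; apply: Rintegral_ge0 => w _.
  by rewrite -mulmxA dot_adj dot_ge0.
have pV2 : psd V2.
  apply/psd_dot; split=> [|v]; first by rewrite /V2 -Emx_tr; under eq_fun do rewrite trmx_mul trmxK.
  rewrite dot_EmxE //; apply: Rintegral_ge0 => w _.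
  by rewrite -mulmxA dot_adj trmxK dot_ge0.
apply: (seg_coercive (s2 := sigmaB ^+ 2)) => //.
- by move=> x; apply: le_trans (opnorm_ge _ _) _; exact: ler_wpM2r (dot_ge0 _) _ _ hr.
- by move=> y; apply: le_trans (opnorm_ge _ _) _; exact: ler_wpM2r (dot_ge0 _) _ _ hl.
- by move=> x; apply: lambda_min_le; rewrite trmx_mul trmxK.
- by move=> y; rewrite -lambda_min_gram_eq //; apply: lambda_min_le; rewrite trmx_mul trmxK.
- exact: sqr_ge0.
Qed.

End seg_noise.

(** * Step size and epoch length *)

Section epoch_length.
Context {R : realType}.

(** With u = sqrt k and w = sqrt v, the bound reads r u^2 >= 2 + w u, and the
    positive root of r u^2 - w u - 2 is 4 / (sqrt (v + 8 r) - w).  For [r = 0]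
    the quotient is a division by zero, so that [k = 0]. *)
Lemma epoch_length_bound (v r : R) : 0 <= v -> 0 <= r ->
  let k := `|Num.ceil ((4 / (Num.sqrt (v + 8 * r) - Num.sqrt v)) ^+ 2)|%N in
  (0 < k)%N -> 0 < r /\ 2 + Num.sqrt (k%:R * v) <= r * k%:R.
Proof.
move=> v0 r0 k k0.
set a := Num.sqrt (v + 8 * r) in k k0 *; set b := Num.sqrt v in k k0 *.
have aa : a ^+ 2 = v + 8 * r by rewrite sqr_sqrtr // addr_ge0 // mulr_ge0.
have bb : b ^+ 2 = v by rewrite sqr_sqrtr.
have b0 : 0 <= b by exact: sqrtr_ge0.
have a0 : 0 <= a by exact: sqrtr_ge0.
have ab : b <= a by rewrite ler_wsqrtr // lerDl mulr_ge0.
have ab0 : a - b != 0.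
  by apply: contraTneq k0 => h; rewrite /k h invr0 mulr0 expr0n /= ceil0.
have abp : 0 < a - b by rewrite lt_neqAle eq_sym ab0 subr_ge0.
have kge : (4 / (a - b)) ^+ 2 <= k%:R.
  apply: le_trans (ceil_ge _) _; rewrite /k natr_absz ger0_norm //.
  by rewrite ceil_ge0 (lt_le_trans _ (sqr_ge0 _)) // ltrN10.
pose u := Num.sqrt (k%:R : R).
have u0 : 0 <= u by exact: sqrtr_ge0.
have uu : u ^+ 2 = k%:R by rewrite sqr_sqrtr.
have up : 4 <= u * (a - b).
  rewrite -ler_pdivrMr // -(@ler_pXn2r _ 2) ?nnegrE ?uu //.
  by rewrite divr_ge0 // ltW.
have rE : r = (a - b) * (a + b) / 8.
  by rewrite -subr_sqr aa bb; field.
have -> : Num.sqrt (k%:R * v) = u * b by rewrite sqrtrM.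
split; first by rewrite rE divr_gt0 // mulr_gt0 // ltr_wpDr // (le_lt_trans b0) // -subr_gt0.
rewrite -uu rE; set p := u * (a - b) in up.
have -> : (a - b) * (a + b) / 8 * u ^+ 2 = p ^+ 2 / 8 + p * (u * b) / 4 by rewrite /p; field.
have ub : 0 <= u * b by exact: mulr_ge0.
nra.
Qed.

End epoch_length.

Section step_size.
Context d0 (Omega0 : measurableType d0) (R : realType) (P0 : probability Omega0 R).
Context n (xi : {RV P0 >-> triple R n n}) (sigmaB sigmaB2 : R).
Hypothesis hA1 : noiseB P0 xi sigmaB sigmaB2.
Hypothesis hB : Bmean P0 xi \in unitmx.
Variable alpha : R.
Hypothesis halpha : 0 < alpha < 1.

Notation B := (Bmean P0 xi).
Notation eta := (etabar P0 xi sigmaB alpha).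
Notation lam := (lambda_min (B *m B^T)).
Notation rate := (RATE P0 xi sigmaB alpha).

(** In dimension zero the spectrum is empty and its supremum is [0]. *)
Lemma dim_gt0 : (0 < n)%N.
Proof.
rewrite lt0n; apply/eqP => n0.
have := noiseB_neq0 hA1; suff -> : lambda_max (B^T *m B) = 0 by rewrite ltxx.
rewrite /lambda_max (_ : [set a | _] = set0) ?sup0 //.
rewrite -subset0 => a /= /eigenvalueP[v _ /eqP]; apply; apply/rowP => i.
by case: i => i hi; exfalso; move: hi; rewrite n0.
Qed.

Hypothesis rate0 : 0 < rate.

Lemma rate_sqr : rate ^+ 2 * expR 1 ^+ 2 = (1 - alpha) * eta ^+ 2 * lam.
Proof.
move: rate0; rewrite /RATE sqrtr_gt0 => h.
by rewrite sqr_sqrtr ?ltW // divfK // expf_neq0 // gt_eqF // expR_gt0.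
Qed.

Lemma step_eta_neq0 : eta != 0.
Proof.
move: rate0; rewrite /RATE sqrtr_gt0; apply: contraTneq => ->.
by rewrite expr0n /= mulr0 !mul0r ltxx.
Qed.

Lemma lam_gt0 : 0 < lam.
Proof.
have /andP[_ a1] := halpha.
move: rate0; rewrite /RATE sqrtr_gt0 pmulr_lgt0 ?invr_gt0 ?exprn_gt0 ?expR_gt0 //.
by rewrite pmulr_rgt0 // mulr_gt0 ?subr_gt0 // exprn_even_gt0 //= step_eta_neq0.
Qed.

Lemma lam_le_max : lam <= lambda_max (B^T *m B).
Proof.
rewrite -lambda_min_gram_eq //; apply: lambda_min_le_max; first exact: dim_gt0.
by rewrite trmx_mul trmxK.
Qed.

Lemma step_le_etaM : eta <= etaM P0 xi.
Proof. by rewrite /etabar; case: ifP => // _; rewrite ge_min lexx. Qed.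

Lemma step_eta_gt0 : 0 < eta.
Proof.
have /andP[a0 _] := halpha.
rewrite lt_neqAle eq_sym step_eta_neq0 /= /etabar; case: ifP => _.
  by rewrite invr_ge0 sqrtr_ge0.
rewrite le_min invr_ge0 sqrtr_ge0 /= divr_ge0 //; first by rewrite mulr_ge0 ?ltW // lam_gt0.
by rewrite mulr_ge0 ?sqrtr_ge0 // mulr_ge0 // sqr_ge0.
Qed.

(** For a nonpositive maximum [etaM] would be [0], which [eta > 0] excludes. *)
Lemma step_rho r : r <= Num.max (rho1 P0 xi) (rho2 P0 xi) -> eta ^+ 2 * r <= 1.
Proof.
set mx := Num.max _ _ => rmx.
have e0 := step_eta_gt0; have := step_le_etaM; rewrite /etaM -/mx => h.
have s0 : 0 < Num.sqrt mx by rewrite -invr_gt0; exact: lt_le_trans h.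
have m0 : 0 < mx by rewrite -sqrtr_gt0.
apply: le_trans (ler_wpM2l (sqr_ge0 _) rmx) _.
rewrite -(sqr_sqrtr (ltW m0)) -exprMn expr_le1 //; last by rewrite mulr_ge0 // ltW.
by rewrite -ler_pdivlMr // mul1r.
Qed.

Let left_le_max (p q : R) : p <= Num.max p q.
Proof. by rewrite le_max lexx. Qed.

Let right_le_max (p q : R) : q <= Num.max p q.
Proof. by rewrite le_max lexx orbT. Qed.

Lemma step_fourth_moment1 x :
  eta ^+ 2 * dot x (M2mean P0 xi *m x) <= dot x (Mmean P0 xi *m x).
Proof.
have := noiseB_pos hA1; rewrite lt_min => /andP[l1 _].
have sM := Mmean_sym xi.
have p0 : 0 <= dot x (Mmean P0 xi *m x).
  by apply: le_trans (lambda_min_le x sM); rewrite mulr_ge0 ?dot_ge0 // ltW.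
have := lambda_max_whitened x sM (M2mean_sym xi) l1; rewrite -/(rho1 P0 xi) => h.
apply: le_trans (ler_wpM2l (sqr_ge0 _) h) _.
by rewrite mulrA; apply: ler_piMl p0 _; apply: step_rho; exact: left_le_max.
Qed.

Lemma step_fourth_moment2 x :
  eta ^+ 2 * dot x (Mhat2mean P0 xi *m x) <= dot x (Mhatmean P0 xi *m x).
Proof.
have := noiseB_pos hA1; rewrite lt_min => /andP[_ l1].
have sM := Mhatmean_sym xi.
have p0 : 0 <= dot x (Mhatmean P0 xi *m x).
  by apply: le_trans (lambda_min_le x sM); rewrite mulr_ge0 ?dot_ge0 // ltW.
have := lambda_max_whitened x sM (Mhat2mean_sym xi) l1; rewrite -/(rho2 P0 xi) => h.
apply: le_trans (ler_wpM2l (sqr_ge0 _) h) _.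
by rewrite mulrA; apply: ler_piMl p0 _; apply: step_rho; exact: right_le_max.
Qed.

(** Square the second bound on [eta], then use that the least eigenvalue of
    B B^T is at most the greatest one of B^T B. *)
Lemma step_variance : 4 * eta ^+ 2 * (sigmaB ^+ 2) ^+ 2 <= alpha ^+ 2 * lam.
Proof.
have /andP[a0 _] := halpha; have l0 := lam_gt0; have lL := lam_le_max.
have e0 := step_eta_gt0.
have [s0|s0] := eqVneq sigmaB 0.
  by rewrite s0 expr0n /= expr0n /= mulr0 mulr_ge0 ?sqr_ge0 // ltW.
set L := lambda_max _ in lL; have L0 : 0 < L by exact: lt_le_trans lL.
have s2 : 0 < sigmaB ^+ 2 by rewrite exprn_even_gt0.
have q0 : 0 < 2 * sigmaB ^+ 2 * Num.sqrt L by rewrite mulr_gt0 ?sqrtr_gt0 // mulr_gt0.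
have : eta <= alpha * lam / (2 * sigmaB ^+ 2 * Num.sqrt L).
  by rewrite /etabar (negbTE s0) ge_min lexx orbT.
rewrite ler_pdivlMr // => h.
have h2 : (eta * (2 * sigmaB ^+ 2 * Num.sqrt L)) ^+ 2 <= (alpha * lam) ^+ 2.
  by rewrite ler_pXn2r // nnegrE mulr_ge0 // ltW.
rewrite -(ler_pM2r L0).
have -> : 4 * eta ^+ 2 * (sigmaB ^+ 2) ^+ 2 * L = (eta * (2 * sigmaB ^+ 2 * Num.sqrt L)) ^+ 2.
  by rewrite !exprMn sqr_sqrtr ?ltW //; ring.
apply: le_trans h2 _; have -> : (alpha * lam) ^+ 2 = alpha ^+ 2 * lam * lam by ring.
exact: ler_wpM2l (mulr_ge0 (sqr_ge0 alpha) (ltW l0)) _ _ lL.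
Qed.

End step_size.

(** * Decay over the restarts *)

Section restarted_seg.
Context (R : realType) (n : nat).
Context d0 (Omega0 : measurableType d0) (P0 : probability Omega0 R).
Context (xi : {RV P0 >-> triple R n n}).
Context d (Omega : measurableType d) (P : probability Omega R).
Context (X : nat -> {RV P >-> triple R n n}).
Hypothesis iidX : iid_copies xi X.

Let indX : independent_family P [set t | (1 <= t)%N] (fun t => X t : Omega -> _) := iidX.1.
Let lawX := iidX.2.

Section vanishing_noise.
Hypothesis hA2 : noiseg P0 xi 0.

(** The second moment of the sample noise is zero, hence so is that of each copy;
    countably many null sets are discarded at once. *)
Lemma noise_vanishes : {ae P, forall w, forall t, (1 <= t)%N -> gx (X t) w = 0 /\ gy (X t) w = 0}.
Proof.
pose h (s : triple R n n) : R := dot s.1.2 s.1.2 + dot s.2 s.2.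
have [_ m1 m2] := measurable_triple (@measurable_id _ (triple R n n) setT).
have mdot (f : triple R n n -> 'cV[R]_n) : mx_measurable f ->
    measurable_fun setT (fun s => dot (f s) (f s)).
  move=> mf; under eq_fun do rewrite dotE.
  by apply: measurable_sum => i; apply: measurable_funM; exact: mf.
have mh : measurable_fun setT (fun s => (h s)%:E).
  by apply/measurable_EFinP; apply: measurable_funD; exact: mdot.
have h0 s : 0 <= h s by rewrite addr_ge0 // dot_ge0.
have Eh : (\int[P0]_w (h (xi w))%:E = 0)%E.
  apply/le_anti/andP; split; last by apply: integral_ge0 => w _; rewrite lee_fin.
  have := noiseg_var hA2; rewrite expr0n /= unlock; apply: le_trans.
  by rewrite le_eqVlt; apply/orP; left; apply/eqP; apply: eq_integral => w _; rewrite !enorm_sqr.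
have ih : P0.-integrable setT (fun w => (h (xi w))%:E).
  apply/integrableP; split; first exact: (measurableT_comp mh).
  under eq_integral => w _ do rewrite /= ger0_norm //.
  by rewrite Eh.
have aet t : {ae P, forall w, (1 <= t)%N -> gx (X t) w = 0 /\ gy (X t) w = 0}.
  have [t1|t1] := leqP 1 t; last by apply: aeW => w; case: t t1.
  have : (\int[P]_w `|(h (X t w))%:E| = 0)%E.
    under eq_integral => w _ do rewrite /= ger0_norm //.
    by rewrite (integral_law lawX mh t1 ih) Eh.
  move=> /(ae_eq_integral_abs _ measurableT (measurableT_comp mh (measurable_funPT (X t)))).
  apply: filterS => w /= /(_ I) [] /eqP; rewrite /h paddr_eq0 ?dot_ge0 // !dot_eq0.
  by move=> /andP[/eqP hx /eqP hy]; split; [exact: hx|exact: hy].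
have := ae_foralln aet; apply: filterS => w h1 t; exact: h1.
Qed.

End vanishing_noise.

Variables (eta : R) (k : nat).
Let F (s : triple R n n) := segF eta s.1.1.

Let mF i j : measurable_fun setT (fun s => F s i j).
Proof.
have [mB _ _] := measurable_triple (@measurable_id _ (triple R n n) setT).
exact: (mx_measurable_segF eta (G := fun s : triple R n n => s.1.1) mB i j).
Qed.

(** The restarting points of the noiseless run, stacked.  Unlike [epoch_avg] they
    depend on the past through the random matrices alone. *)
Fixpoint restart_point (z0 : 'cV[R]_(n + n)) (q : nat) : Omega -> 'cV[R]_(n + n) :=
  if q is q'.+1 then
    fun w => k%:R^-1 *: \sum_(1 <= r < k.+1) trajectory X F (q' * k) (restart_point z0 q') r w
  else fun=> z0.

Hypothesis sF : forall i j, sqint P0 (fun w => F (xi w) i j).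

Lemma restart_point_sq z0 q :
  advec X (q * k) (restart_point z0 q) /\ sqvec P (restart_point z0 q).
Proof.
elim: q => [|q [aZ sZ]]; first by split; [exact: advec_cst|exact: sqvec_cst].
split=> /=; last first.
  by apply: sqvecZ; apply: sqvec_sum => r; exact: (trajectory_sqvec indX lawX).
apply: advecZ; rewrite mulSn addnC.
have h j : (j <= k)%N -> advec X (q * k + k)
    (fun w => \sum_(1 <= r < j.+1) trajectory X F (q * k) (restart_point z0 q) r w).
  elim: j => [|j IH] jk.
    by under eq_fun do rewrite big_geq //; exact: advec_cst.
  under eq_fun do rewrite big_nat_recr //=.
  apply: advecD; first by apply: IH; exact: ltnW.
  apply: (@advec_subn _ _ _ _ _ _ _ (q * k + j.+1)); first by rewrite leq_add2l.
  exact: trajectory_advec.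
exact: h.
Qed.

Lemma stack_seg_iter w tau (Z : Omega -> 'cV[R]_(n + n)) z r :
  (forall t, (1 <= t)%N -> gx (X t) w = 0 /\ gy (X t) w = 0) ->
  stack z = Z w ->
  stack (seg_iter eta (fun t => X t w) tau z r) = trajectory X F tau Z r w.
Proof.
move=> h hz; elim: r => [|r IH] //=.
have [hx hy] : gx (X (tau + r.+1)) w = 0 /\ gy (X (tau + r.+1)) w = 0.
  by apply: h; rewrite addnS.
rewrite -IH /F -stack_seg_step; congr (stack (seg_step _ _ _)).
by move: hx hy; rewrite /gx /gy; case: (X _ w) => -[b g g'] /= -> ->.
Qed.

Lemma stack_sum (I : Type) (r : seq I) (f : I -> 'cV[R]_n * 'cV[R]_n) :
  stack (\sum_(i <- r) f i) = \sum_(i <- r) stack (f i).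
Proof.
apply: (big_morph (@stack R n n)); last exact: col_mx0.
by move=> x y; rewrite /stack /= add_col_mx.
Qed.

Lemma stackZ c (z : 'cV[R]_n * 'cV[R]_n) : stack (c *: z) = c *: stack z.
Proof. by rewrite /stack scale_col_mx. Qed.

Lemma stack_epoch_avg w z0 q :
  (forall t, (1 <= t)%N -> gx (X t) w = 0 /\ gy (X t) w = 0) ->
  stack (epoch_avg eta (fun t => X t w) k z0 q) = restart_point (stack z0) q w.
Proof.
move=> h; elim: q => [|q IH] //=.
rewrite stackZ stack_sum; congr (_ *: _).
by apply: eq_bigr => r _; exact: stack_seg_iter.
Qed.

Lemma seg_iter_measurable tau (z : Omega -> 'cV[R]_n * 'cV[R]_n) r :
  mx_measurable (fun w => (z w).1) -> mx_measurable (fun w => (z w).2) ->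
  mx_measurable (fun w => (seg_iter eta (fun t => X t w) tau (z w) r).1) /\
  mx_measurable (fun w => (seg_iter eta (fun t => X t w) tau (z w) r).2).
Proof.
move=> m1 m2; elim: r => [|r [h1 h2]] //=.
have [mB mx my] := measurable_triple (measurable_funPT (X (tau + r.+1))).
have mBT := mx_measurable_tr mB.
have affine (A : Omega -> 'M[R]_n) (v g : Omega -> 'cV[R]_n) :
    mx_measurable A -> mx_measurable v -> mx_measurable g ->
    mx_measurable (fun w => eta *: (A w *m v w + g w)).
  by move=> mA mv mg; exact: mx_measurableZ (mx_measurableD (mx_measurableM mA mv) mg).
have hx := mx_measurableB h1 (affine _ _ _ mB h2 mx).
have hy := mx_measurableD h2 (affine _ _ _ mBT h1 my).
split; first exact: mx_measurableB h1 (affine _ _ _ mB hy mx).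
exact: mx_measurableD h2 (affine _ _ _ mBT hx my).
Qed.

Lemma epoch_avg_measurable z0 q :
  mx_measurable (fun w => (epoch_avg eta (fun t => X t w) k z0 q).1) /\
  mx_measurable (fun w => (epoch_avg eta (fun t => X t w) k z0 q).2).
Proof.
have fst_sum (I : Type) (r : seq I) (f : I -> 'cV[R]_n * 'cV[R]_n) :
  (\sum_(i <- r) f i).1 = \sum_(i <- r) (f i).1 by exact: big_morph.
have snd_sum (I : Type) (r : seq I) (f : I -> 'cV[R]_n * 'cV[R]_n) :
  (\sum_(i <- r) f i).2 = \sum_(i <- r) (f i).2 by exact: big_morph.
elim: q => [|q [h1 h2]]; first by split; exact: mx_measurable_cst.
split=> /=; apply: mx_measurableZ.
  under eq_fun do rewrite fst_sum.
  by apply: mx_measurable_sum => r; exact: (seg_iter_measurable _ _ h1 h2).1.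
under eq_fun do rewrite snd_sum.
by apply: mx_measurable_sum => r; exact: (seg_iter_measurable _ _ h1 h2).2.
Qed.

(** The two runs agree almost surely; measurability of the original one makes
    their expectations comparable. *)
Lemma expect_output z0 q : noiseg P0 xi 0 ->
  'E_P[fun w => (enorm (epoch_avg eta (fun t => X t w) k z0 q).1 ^+ 2
               + enorm (epoch_avg eta (fun t => X t w) k z0 q).2 ^+ 2)%R]%E
  = (mean_sq P (restart_point (stack z0) q))%:E.
Proof.
move=> hA2; have [aZ sZ] := restart_point_sq (stack z0) q.
rewrite /mean_sq /Rintegral fineK; last by apply: integrable_fin_num => //; exact: integrable_dot.
rewrite unlock.
have [h1 h2] := epoch_avg_measurable z0 q.
have mdot (f : Omega -> 'cV[R]_n) : mx_measurable f ->
    measurable_fun setT (fun w => enorm (f w) ^+ 2).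
  move=> mf; under eq_fun do rewrite enorm_sqr dotE.
  by apply: measurable_sum => i; apply: measurable_funM; exact: mf.
apply: ge0_ae_eq_integral => //.
- by apply/measurable_EFinP; apply: measurable_funD; exact: mdot.
- by apply: (@measurable_int _ _ _ P); exact: integrable_dot.
- by move=> w _; rewrite lee_fin addr_ge0 // sqr_ge0.
- by move=> w _; rewrite lee_fin dot_ge0.
have := noise_vanishes hA2; apply: filterS => w hw _.
by rewrite -stack_epoch_avg // /stack dot_col_mx !enorm_sqr.
Qed.

End restarted_seg.

Lemma noise_level_ge0 (R : realType) (eta s s2 : R) :
  0 <= 2 * eta ^+ 2 * (s ^+ 2 + eta ^+ 2 * s2 ^+ 2).
Proof.
have e2 := sqr_ge0 eta; apply: mulr_ge0; first exact: mulr_ge0.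
by rewrite addr_ge0 ?sqr_ge0 // mulr_ge0 // sqr_ge0.
Qed.

Section contraction.
Context (R : realType) (n : nat).
Context d0 (Omega0 : measurableType d0) (P0 : probability Omega0 R).
Context (xi : {RV P0 >-> triple R n n}).
Context d (Omega : measurableType d) (P : probability Omega R).
Context (X : nat -> {RV P >-> triple R n n}).
Hypothesis iidX : iid_copies xi X.
Variables (sigmaB sigmaB2 alpha : R).
Hypothesis hB : Bmean P0 xi \in unitmx.
Hypothesis hA1 : noiseB P0 xi sigmaB sigmaB2.
Hypothesis halpha : 0 < alpha < 1.

Notation eta := (etabar P0 xi sigmaB alpha).
Notation rate := (RATE P0 xi sigmaB alpha).
Notation v := (2 * eta ^+ 2 * (sigmaB ^+ 2 + eta ^+ 2 * sigmaB2 ^+ 2)).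

(** [epoch_le] with the constants of the SEG matrix; the factor e^2 is what
    separates the coercivity constant from [rate ^+ 2]. *)
Lemma restart_contraction k z0 q : (0 < k)%N -> 0 < rate ->
  2 + Num.sqrt (k%:R * v) <= rate * k%:R ->
  mean_sq P (restart_point X eta k z0 q.+1) <=
    expR (- 2) * mean_sq P (restart_point X eta k z0 q).
Proof.
move=> k0 r0 hk.
have [mB _ _] := measurable_triple (@measurable_id _ (triple R n n) setT).
pose F (s : triple R n n) := segF eta s.1.1.
have mF i j : measurable_fun setT (fun s => F s i j).
  exact: (mx_measurable_segF eta (G := fun s : triple R n n => s.1.1) mB i j).
have sF : forall i j, sqint P0 (fun w => F (xi w) i j) by exact: (segF_sqint hA1 eta).
have v0 : 0 <= v by exact: noise_level_ge0.
have a1 : 0 <= alpha <= 1 by have /andP[/ltW -> /ltW ->] := halpha.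
have [aZ sZ] := restart_point_sq iidX k sF z0 q.
have := epoch_le iidX.1 iidX.2 mF sF
  (fun z => segF_nonexpansive hA1 z (step_fourth_moment1 hA1 halpha r0)
     (step_fourth_moment2 hA1 halpha r0))
  (segF_variance hA1 eta)
  (fun z => segF_coercive hA1 z hB (ltW (step_eta_gt0 halpha r0)) a1
     (step_variance hA1 hB halpha r0))
  aZ sZ k v0.
set S := fun w => \sum_(1 <= s < k.+1) _.
rewrite -(rate_sqr r0); set Z := restart_point X eta k z0 q.
move=> hS.
have kp : 0 < k%:R :> R by rewrite ltr0n.
have -> : mean_sq P (restart_point X eta k z0 q.+1) = (k%:R ^+ 2)^-1 * mean_sq P S.
  rewrite /mean_sq -Rintegral_dotZ; last 2 first.
  - by apply: sqvec_sum => r; exact: (trajectory_sqvec iidX.1 iidX.2).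
  - by apply: sqvec_sum => r; exact: (trajectory_sqvec iidX.1 iidX.2).
  apply: eq_Rintegral => w _ /=; rewrite dotZl dotZr mulrA; congr (_ * _).
  by field; rewrite gt_eqF.
have Z0 : 0 <= mean_sq P Z by apply: Rintegral_ge0 => w _; exact: dot_ge0.
have hk2 : (2 + Num.sqrt (k%:R * v)) ^+ 2 <= (rate * k%:R) ^+ 2.
  by rewrite ler_pXn2r // nnegrE ?addr_ge0 ?sqrtr_ge0 ?mulr_ge0 ?ltW.
have h1 := le_trans hS (ler_wpM2r Z0 hk2).
have : rate ^+ 2 * (expR 1 ^+ 2 * mean_sq P S) <= rate ^+ 2 * (k%:R ^+ 2 * mean_sq P Z).
  by rewrite mulrA; apply: le_trans h1 _; rewrite exprMn mulrA.
rewrite ler_pM2l; last exact: exprn_gt0.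
rewrite -ler_pdivlMl; last by rewrite exprn_gt0 // expR_gt0.
move=> h; rewrite ler_pdivrMl ?exprn_gt0 //; apply: le_trans h _.
rewrite -[X in expR (- X)](mulr_natl 1 2) expRN expRM_natl le_eqVlt; apply/orP; left; apply/eqP.
by ring.
Qed.

Lemma restart_decay k z0 q : (0 < k)%N -> 0 < rate ->
  2 + Num.sqrt (k%:R * v) <= rate * k%:R ->
  mean_sq P (restart_point X eta k z0 q) <= expR (- (2 * q%:R)) * dot z0 z0.
Proof.
move=> k0 r0 hk; elim: q => [|q IH].
  by rewrite /mean_sq /= Rintegral_prob_cst mulr0 oppr0 expR0 mul1r.
apply: le_trans (restart_contraction _ _ k0 r0 hk) _.
apply: le_trans (ler_wpM2l (expR_ge0 _) IH) _.
have -> : - (2 * q.+1%:R) = - 2 + - (2 * q%:R) :> R by rewrite -(natr1 q); ring.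
by rewrite expRD mulrA.
Qed.

End contraction.

Theorem theorem3p3
  (R : realType) (n : nat)
  (d0 : measure_display) (Omega0 : measurableType d0) (P0 : probability Omega0 R)
  (xi : {RV P0 >-> triple R n n})
  (d : measure_display) (Omega : measurableType d) (P : probability Omega R)
  (X : nat -> {RV P >-> triple R n n})
  (iidX : iid_copies xi X)
  (x0 y0 : 'cV[R]_n)
  (sigmaB sigmaB2 : R)
  (hB : Bmean P0 xi \in unitmx)
  (hA1 : noiseB P0 xi sigmaB sigmaB2)
  (hA2 : noiseg P0 xi 0)
  (alpha : R) (halpha : 0 < alpha < 1)
  (K : nat) :
  let eta := etabar P0 xi sigmaB alpha in
  let Kt := Kthres P0 xi sigmaB sigmaB2 alpha in
  let z := fun w : Omega =>
    rseg_output (fun i => (i * Kt)%N) eta (fun t => X t w) (x0, y0) K in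
  (1 <= K)%N -> (Kt %| K)%N ->
  ('E_P[fun w => (enorm (z w).1 ^+ 2 + enorm (z w).2 ^+ 2)%R]
     <= (expR (- (2 / Kt%:R * K%:R))
           * (enorm x0 ^+ 2 + enorm y0 ^+ 2))%:E)%E.
Proof.
move=> eta Kt z K1 /dvdnP[q Kq].
have Kt0 : (0 < Kt)%N by rewrite lt0n; apply: contraTneq K1 => h; rewrite Kq h muln0.
have sF i j : sqint P0 (fun w => segF eta (xi w).1.1 i j) by exact: (segF_sqint hA1 eta).
have [rate0 hKt] : 0 < RATE P0 xi sigmaB alpha /\
    2 + Num.sqrt (Kt%:R * (2 * eta ^+ 2 * (sigmaB ^+ 2 + eta ^+ 2 * sigmaB2 ^+ 2)))
    <= RATE P0 xi sigmaB alpha * Kt%:R.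
  apply: epoch_length_bound => //; last exact: sqrtr_ge0.
  exact: noise_level_ge0.
have -> : z = fun w => epoch_avg eta (fun t => X t w) Kt (x0, y0) q.
  by apply/funext => w; rewrite /z Kq rseg_outputE.
rewrite (expect_output iidX Kt sF) // lee_fin.
apply: le_trans (restart_decay iidX hB hA1 halpha _ q Kt0 rate0 hKt) _.
rewrite /stack dot_col_mx !enorm_sqr Kq natrM.
have -> : 2 / Kt%:R * (q%:R * Kt%:R) = 2 * q%:R :> R by field; rewrite pnatr_eq0 -lt0n.
by [].
Qed.
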